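(* Let $(S,P)$ be a pure $\Gamma$-contraction on a Hilbert space $\mathcal H$, and let $F_*\in\mathcal B(\mathcal D_{P^*})$ be the fundamental operator of the $\Gamma$-contraction $(S^*,P^* )$. Let $$\mathbb H_P=(H^2(\mathbb D)\otimes \mathcal D_{P^*})\ominus M_{\Theta_P}(H^2(\mathbb D)\otimes \mathcal D_P),$$ and define operators on $\mathbb H_P$ by $$S_1=P_{\mathbb H_P}(I\otimes F_*^*+M_z\otimes F_* )|_{\mathbb H_P},\qquad P_1=P_{\mathbb H_P}(M_z\otimes I)|_{\mathbb H_P},$$ where $P_{\mathbb H_P}$ denotes the orthogonal projection of $H^2(\mathbb D)\otimes\mathcal D_{P^*}$ onto $\mathbb H_P$. Then $(S,P)$ is unitarily equivalent to $(S_1,P_1)$, i.e. there is a unitary $U:\mathcal H\to\mathbb H_P$ with $US=S_1U$ and $UP=P_1U$.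
   Context: All Hilbert spaces are complex. Let $\Gamma=\{(z_1+z_2,z_1z_2): |z_1|\le 1,\ |z_2|\le 1\}\subseteq\mathbb C^2$ (the closed symmetrized bidisc). A pair $(S,P)$ of commuting bounded operators on a Hilbert space $\mathcal H$ is a $\Gamma$-contraction if $\Gamma$ is a spectral set for it; since $\Gamma$ is polynomially convex, this is equivalent to $\|p(S,P)\|\le \sup_{z\in\Gamma}|p(z)|$ for every complex polynomial $p$ in two variables. Then $P$ is a contraction, and $(S^*,P^* )$ is also a $\Gamma$-contraction. A $\Gamma$-contraction $(S,P)$ is pure if $P^{*n}\to 0$ strongly as $n\to\infty$. For a contraction $P$, put $D_P=(I-P^*P)^{1/2}$, $D_{P^*}=(I-PP^* )^{1/2}$, $\mathcal D_P=\overline{\mathrm{Ran}}\,D_P$, $\mathcal D_{P^*}=\overline{\mathrm{Ran}}\,D_{P^*}$. The fundamental operator of a $\Gamma$-contraction $(S,P)$ is the unique $F\in\mathcal B(\mathcal D_P)$ satisfying $S-S^*P=D_PFD_P$ (existence and uniqueness are known for every $\Gamma$-contraction). Thus the fundamental operator $F_*$ of $(S^*,P^* )$ is the unique $F_*\in\mathcal B(\mathcal D_{P^*})$ with $S^*-SP^*=D_{P^*}F_*D_{P^*}$. The characteristic function of a contraction $P$ is $\Theta_P(z)=[-P+zD_{P^*}(I-zP^* )^{-1}D_P]|_{\mathcal D_P}$, $z\in\mathbb D$, an analytic function with values in $\mathcal B(\mathcal D_P,\mathcal D_{P^*})$. $H^2(\mathbb D)$ is the Hardy space of the unit disc, $M_z$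 is multiplication by $z$ on it, and $M_{\Theta_P}:H^2(\mathbb D)\otimes\mathcal D_P\to H^2(\mathbb D)\otimes\mathcal D_{P^*}$ is the multiplication operator by $\Theta_P$, where $H^2(\mathbb D)\otimes\mathcal E$ is identified with the $\mathcal E$-valued Hardy space. *)

(* Defs.v *)
From HB Require Import structures.
From mathcomp Require Import all_boot all_order all_algebra.
From mathcomp Require Import all_classical all_reals topology normedtype.
From mathcomp Require Import sequences.
From mathcomp Require Import complex ring.
Set Implicit Arguments.
Unset Strict Implicit.
Unset Printing Implicit Defensive.
Import Order.TTheory GRing.Theory Num.Theory.
Import numFieldNormedType.Exports numFieldTopology.Exports.
Local Open Scope classical_set_scope.
Local Open Scope ring_scope.

HB.instance Definition _ (R : realType) := NormedModule.copy R[i] R[i]^o.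

Section complex_topology.
Context {R : realType}.
Implicit Types (T : Type).

Lemma le_normRe (x : R[i]) : (`|complex.Re x|%:C)%C <= `|x|.
Proof. exact: normc_ge_Re. Qed.

Lemma le_normIm (x : R[i]) : (`|complex.Im x|%:C)%C <= `|x|.
Proof.
case: x => a b; rewrite normc_def lecR /= -sqrtr_sqr.
by rewrite ler_sqrt ?addr_ge0 ?sqr_ge0// lerDr sqr_ge0.
Qed.

Lemma ge0_ReE (x : R[i]) : 0 <= x -> x = ((complex.Re x)%:C)%C.
Proof. by move=> x0; rewrite RRe_real// ger0_real. Qed.

Lemma norm_le_ReIm (x : R[i]) :
  `|x| <= ((`|complex.Re x| + `|complex.Im x|)%:C)%C.
Proof.
case: x => a b; rewrite normc_def lecR /=.
rewrite -[leRHS]ger0_norm ?addr_ge0// -sqrtr_sqr ler_sqrt ?sqr_ge0//.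
rewrite sqrrD !real_normK ?num_real// -addrA [X in _ <= _ + X]addrC addrA.
by rewrite lerDl mulrn_wge0// mulr_ge0.
Qed.

Lemma cvg_Re T (F : set_system T) {FF : Filter F} (u : T -> R[i]) (l : R[i]) :
  u x @[x --> F] --> l -> complex.Re (u x) @[x --> F] --> complex.Re l.
Proof.
move=> /cvgrPdist_lt ul; apply/cvgrPdist_lt => e e0.
have /ul : 0 < (e%:C)%C :> R[i] by rewrite ltcR.
apply: filterS => x lx.
rewrite -ltcR (le_lt_trans _ lx)//.
have -> : complex.Re l - complex.Re (u x) = complex.Re (l - u x).
  by case: l {ul lx} => ? ?; case: (u x).
exact: le_normRe.
Qed.

Lemma cvg_Im T (F : set_system T) {FF : Filter F} (u : T -> R[i]) (l : R[i]) :
  u x @[x --> F] --> l -> complex.Im (u x) @[x --> F] --> complex.Im l.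
Proof.
move=> /cvgrPdist_lt ul; apply/cvgrPdist_lt => e e0.
have /ul : 0 < (e%:C)%C :> R[i] by rewrite ltcR.
apply: filterS => x lx.
rewrite -ltcR (le_lt_trans _ lx)//.
have -> : complex.Im l - complex.Im (u x) = complex.Im (l - u x).
  by case: l {ul lx} => ? ?; case: (u x).
exact: le_normIm.
Qed.

Lemma cvg_ReIm T (F : set_system T) {FF : Filter F} (u : T -> R[i]) (a b : R) :
  complex.Re (u x) @[x --> F] --> a -> complex.Im (u x) @[x --> F] --> b ->
  u x @[x --> F] --> (Complex a b : R[i]).
Proof.
move=> /cvgrPdist_lt ua /cvgrPdist_lt ub; apply/cvgrPdist_lt => e e0.
have eE : e = ((complex.Re e)%:C)%C by apply: ge0_ReE; exact: ltW.
have r0 : 0 < complex.Re e / 2 by rewrite divr_gt0// -ltcR -eE.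
have := ub _ r0; have := ua _ r0; apply: filterS2 => x xa xb.
rewrite (le_lt_trans (norm_le_ReIm _))// eE ltcR [ltRHS]splitr.
by case: (u x) xa xb => c d /=; exact: ltrD.
Qed.

Lemma complex_complete (F : set_system R[i]) : ProperFilter F -> cauchy F -> cvg F.
Proof.
move=> PF /cauchyP Fc.
have [ReF ImF] : cvg (complex.Re x @[x --> F]) /\ cvg (complex.Im x @[x --> F]).
  split; apply/cauchy_cvgP/cauchyP => e e0;
    have [|x Fx] := Fc (e%:C)%C; rewrite ?ltcR//.
  - exists (complex.Re x).
    suff : F (@complex.Re R @^-1` ball (complex.Re x) e) by [].
    apply: filterS Fx => y /=.
    rewrite -!ball_normE /ball_ /= => xy. rewrite -ltcR; apply: le_lt_trans xy.
    apply: le_trans (le_normRe _).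
    by case: x => ? ?; case: y.
  - exists (complex.Im x).
    suff : F (@complex.Im R @^-1` ball (complex.Im x) e) by [].
    apply: filterS Fx => y /=.
    rewrite -!ball_normE /ball_ /= => xy; rewrite -ltcR; apply: le_lt_trans xy.
    apply: le_trans (le_normIm _).
    by case: x => ? ?; case: y.
apply/cvg_ex; exists (Complex (lim (complex.Re x @[x --> F]))
                            (lim (complex.Im x @[x --> F])) : R[i]).
by apply: (@cvg_ReIm _ F _ id); [exact: ReF|exact: ImF].
Qed.

HB.instance Definition _ := Uniform_isComplete.Build R[i] complex_complete.

Lemma cvg_ge0C T (F : set_system T) {FF : ProperFilter F} (u : T -> R[i]) (l : R[i]) :
  (\forall x \near F, 0 <= u x) -> u x @[x --> F] --> l -> 0 <= l.
Proof.
move=> u0 ul; rewrite lecE /=; apply/andP; split.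
  apply/eqP; apply: (@closed_cvg _ _ F _ _ (eq^~ (0 : R)) _ _ _ (cvg_Im ul)).
    exact: closed_eq.
  by apply: filterS u0 => x; rewrite lecE /= => /andP[/eqP].
apply: (cvgr_to_ge (cvg_Re ul)).
by apply: filterS u0 => x; rewrite lecE /= => /andP[].
Qed.

Lemma nneseries_is_cvgC (u : nat -> R[i]) (M : R[i]) : (forall n, 0 <= u n) ->
  (forall n, series u n <= M) -> cvgn (series u).
Proof.
move=> u0 uM.
have uE n : series u n = ((series (@complex.Re R \o u) n)%:C)%C.
  rewrite /series /= rmorph_sum /=; apply: eq_bigr => i _; exact: ge0_ReE.
have cR : cvgn (series (@complex.Re R \o u)).
  apply: nondecreasing_is_cvgn.
    apply: nondecreasing_series => n _ _ /=.
    by have := u0 n; rewrite lecE /= => /andP[].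
  exists (complex.Re M) => _ [n _ <-].
  by have := uM n; rewrite uE lecE /= => /andP[].
apply: (@cvgP _ _ (Complex (limn (series (@complex.Re R \o u))) 0 : R[i])).
have -> : series u = (fun n => ((series (@complex.Re R \o u) n)%:C)%C).
  exact/funext.
apply: cvg_ReIm; first exact: cR.
by apply: cvg_near_cst; exact: nearW.
Qed.

Lemma series_le_limC (u : nat -> R[i]) n : (forall n, 0 <= u n) ->
  cvgn (series u) -> series u n <= limn (series u).
Proof.
move=> u0 cu; rewrite -subr_ge0.
apply: (@cvg_ge0C _ \oo _ (fun m => series u m - series u n)); last first.
  apply: cvgB; first exact: cu.
  by apply: cvg_near_cst; exact: nearW.
exists n => // m /= nm; rewrite sub_series nm.
by apply: sumr_ge0.
Qed.

Lemma series_comparisonC (V : completeNormedModType R[i]) (u : nat -> V)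
    (v : nat -> R[i]) :
  (forall n, `|u n| <= v n) -> cvgn (series v) -> cvgn (series u).
Proof.
move=> uv /cvg_cauchy/cauchy_seriesP cv.
apply/cauchy_cvgP/cauchy_seriesP => e e0.
have := cv _ e0; apply: filterS => -[m n] /=; apply: le_lt_trans.
rewrite ger0_norm; last by apply: sumr_ge0 => i _; exact: le_trans (uv i).
by apply: le_trans (ler_norm_sum _ _ _) _; apply: ler_sum.
Qed.

End complex_topology.

(* The inner product hdot is linear in its first argument. *)
HB.mixin Record CompleteNormedModule_isHilbert (R : realType) H
    & CompleteNormedModule R[i] H := {
  hdot : H -> H -> R[i];
  hdot_linear : forall (a : R[i]) (u v w : H),
    hdot (a *: u + v) w = a * hdot u w + hdot v w;
  hdotC : forall u v : H, hdot u v = (hdot v u)^*;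
  hdot_norm : forall u : H, hdot u u = `|u| ^+ 2
}.

#[short(type="hilbertType")]
HB.structure Definition Hilbert (R : realType) :=
  {H of CompleteNormedModule R[i] H & CompleteNormedModule_isHilbert R H}.

Section dot_form.
Context {C : numClosedFieldType} {V : lmodType C} (d : V -> V -> C).
Hypothesis dlin : forall a u v w, d (a *: u + v) w = a * d u w + d v w.
Hypothesis dC : forall u v, d u v = (d v u)^*.
Hypothesis dge0 : forall u, 0 <= d u u.
Hypothesis deq0 : forall u, d u u = 0 -> u = 0.

Lemma dot0l w : d 0 w = 0.
Proof.
by have := dlin (-1) 0 0 w; rewrite scaler0 addr0 mulN1r addNr.
Qed.

Lemma dotDl u v w : d (u + v) w = d u w + d v w.
Proof. by rewrite -[u in LHS]scale1r dlin mul1r. Qed.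

Lemma dotZl a u w : d (a *: u) w = a * d u w.
Proof. by rewrite -[a *: u]addr0 dlin dot0l addr0. Qed.

Lemma dotDr u v w : d u (v + w) = d u v + d u w.
Proof. by rewrite dC dotDl rmorphD /= -!dC. Qed.

Lemma dotZr a u w : d u (a *: w) = a^* * d u w.
Proof. by rewrite dC dotZl rmorphM /= -dC. Qed.

Lemma dot_CauchySchwarz u v : `|d u v| ^+ 2 <= d u u * d v v.
Proof.
have [v0|v0] := eqVneq (d v v) 0.
  by rewrite (deq0 v0) dC !dot0l rmorph0 normr0 mulr0 expr0n.
set x := d u v; set y := d v v.
have y0 : 0 < y by rewrite lt_def v0 dge0.
pose a := - (x / y).
have ac : a^* = - (x^* / y).
  by rewrite /a rmorphN rmorphM /= fmorphV /= /y -dC.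
have := dge0 (u + a *: v).
rewrite dotDl !dotDr !dotZl !dotZr (dC v u) ac -/x -/y /a.
have -> : d u u + - (x^* / y) * x + (- (x / y) * x^* + - (x / y) * (- (x^* / y) * y))
    = (d u u * y - `|x| ^+ 2) / y.
  by rewrite normCK; field; rewrite gt_eqF.
by rewrite pmulr_lge0 ?invr_gt0// subr_ge0.
Qed.

Lemma dot_triangle u v :
  sqrtC (d (u + v) (u + v)) <= sqrtC (d u u) + sqrtC (d v v).
Proof.
rewrite -[leRHS]sqrCK ?addr_ge0 ?sqrtC_ge0// ler_sqrtC ?nnegrE ?sqr_ge0 ?exprn_ge0 ?addr_ge0 ?sqrtC_ge0//.
rewrite sqrrD !sqrtCK dotDl !dotDr addrA lerD2r -addrA lerD2l.
rewrite (dC v u).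
have -> : d u v + (d u v)^* = 'Re (d u v) *+ 2.
  by rewrite ReE -mulr_natr divfK// pnatr_eq0.
rewrite lerMn2r /=; apply: le_trans (leif_Re_Creal _).1 _.
rewrite -ler_sqr ?nnegrE ?mulr_ge0 ?sqrtC_ge0// exprMn !sqrtCK.
exact: dot_CauchySchwarz.
Qed.

Lemma sqrt_dotZ a u : sqrtC (d (a *: u) (a *: u)) = `|a| * sqrtC (d u u).
Proof.
rewrite dotZl dotZr mulrA -normCK rootCMl ?exprn_ge0// sqrCK//.
Qed.

End dot_form.

#[short(type="boundedOp")]
HB.structure Definition BoundedOp (K : numFieldType) (U V : normedModType K) :=
  {f of @GRing.Linear K U V *:%R f & @Continuous U V f}.

Section bounded_op_choice.
Context {K : numFieldType} {U V : normedModType K}.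

HB.instance Definition _ := gen_eqMixin (boundedOp U V).
HB.instance Definition _ := gen_choiceMixin (boundedOp U V).

Fact null_fun_continuous : continuous (\0 : U -> V).
Proof. by move=> x; apply: cvg_near_cst; exact: nearW. Qed.
HB.instance Definition _ := isContinuous.Build U V (\0 : U -> V) null_fun_continuous.
HB.instance Definition _ := isPointed.Build (boundedOp U V) (\0 : U -> V).

End bounded_op_choice.

Record closed_subspace (R : realType) (H : hilbertType R) := ClosedSubspace {
  subspace_set :> set H;
  subspace_set0 : subspace_set 0;
  subspace_setP : forall (a : R[i]) (u v : H),
    subspace_set u -> subspace_set v -> subspace_set (a *: u + v);
  subspace_closed : closed subspace_set
}.

Section subspace_hilbert.
Context {R : realType} {H : hilbertType R} (W : closed_subspace H).

Definition subspace_pred : {pred H} := mem (subspace_set W).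

Fact subspace_submod_closed : submod_closed subspace_pred.
Proof.
split; first exact/mem_set/subspace_set0.
by move=> a u v /set_mem uW /set_mem vW; exact/mem_set/subspace_setP.
Qed.
HB.instance Definition _ := GRing.isSubmodClosed.Build _ _ subspace_pred
  subspace_submod_closed.

(* A closed subspace, as a Hilbert space of its own. *)
Record subHilbert := Subspace_of {
  subspace_val : H;
  subspace_valP : subspace_val \in subspace_pred
}.

HB.instance Definition _ := [isSub for subspace_val].
HB.instance Definition _ := [Choice of subHilbert by <:].
HB.instance Definition _ := [SubChoice_isSubLmodule of subHilbert by <:].

Let nrm (x : subHilbert) : R[i] := `|\val x|.
Let nrmD x y : nrm (x + y) <= nrm x + nrm y.
Proof. exact: ler_normD. Qed.
Let nrmZ (a : R[i]) x : nrm (a *: x) = `|a| * nrm x.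
Proof. exact: normrZ. Qed.
Let nrm0 x : nrm x = 0 -> x = 0.
Proof. by move=> /normr0_eq0 x0; exact: val_inj. Qed.
HB.instance Definition _ := Lmodule_isNormed.Build R[i] subHilbert nrmD nrmZ nrm0.

Lemma subspace_normE (x : subHilbert) : `|x| = `|\val x|.
Proof. by []. Qed.

Let sub_complete (F : set_system subHilbert) : ProperFilter F -> cauchy F -> cvg F.
Proof.
move=> PF /cauchyP Fc.
have /cvg_ex[l Fl] : cvg ((\val x : H) @[x --> F]).
  apply/cauchy_cvgP/cauchyP => e e0; have [x Fx] := Fc e e0.
  exists (\val x); suff : F ((\val : subHilbert -> H) @^-1` ball (\val x) e) by [].
  by apply: filterS Fx => y; rewrite -!ball_normE.
have Wl : subspace_set W l.
  apply: (@closed_cvg _ _ F _ _ _ _ _ _ Fl); first exact: subspace_closed.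
  by apply: nearW => x; exact/set_mem/subspace_valP.
apply/cvg_ex; exists (Subspace_of (mem_set Wl)).
apply/(@cvgrPdist_lt _ _ _ F _ id) => e e0.
by move/cvgrPdist_lt : Fl => /(_ _ e0).
Qed.
HB.instance Definition _ := Uniform_isComplete.Build subHilbert sub_complete.

Let sdot (x y : subHilbert) : R[i] := hdot (\val x) (\val y).
Let sdot_linear (a : R[i]) x y z : sdot (a *: x + y) z = a * sdot x z + sdot y z.
Proof. exact: hdot_linear. Qed.
Let sdotC x y : sdot x y = (sdot y x)^*.
Proof. exact: hdotC. Qed.
Let sdot_norm x : sdot x x = `|x| ^+ 2.
Proof. exact: hdot_norm. Qed.
HB.instance Definition _ := CompleteNormedModule_isHilbert.Build R subHilbert
  sdot_linear sdotC sdot_norm.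

End subspace_hilbert.


Lemma boundedOp_le (K : numFieldType) (U V : normedModType K)
  (A : boundedOp U V) : exists2 M : K, 0 <= M & forall x, `|A x| <= M * `|x|.
Proof.
have cA : {for 0, continuous A} by exact: cts_fun.
have /linear_boundedP := continuous_linear_bounded 0 cA.
by case=> M [M_real MA]; exists (`|M| + 1) => [|x]; [rewrite addr_ge0|apply: MA; rewrite (le_lt_trans (real_ler_norm M_real))// ltrDl].
Qed.

Lemma hdot_CauchySchwarz (R : realType) (H : hilbertType R) (u v : H) :
  `|hdot u v| <= `|u| * `|v|.
Proof.
rewrite -ler_sqr ?nnegrE ?mulr_ge0// exprMn -!hdot_norm.
apply: dot_CauchySchwarz; [exact: hdot_linear|exact: hdotC| |].
- by move=> w; rewrite hdot_norm exprn_ge0.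
- by move=> w /eqP; rewrite hdot_norm expf_eq0 normr_eq0 => /eqP.
Qed.

Lemma cvg_seriesM (K : numFieldType) (c : K) (u : nat -> K) (l : K) :
  series u @ \oo --> l -> series (fun n => c * u n) @ \oo --> c * l.
Proof.
have -> : series (fun n => c * u n) = (fun n => c * series u n).
  by apply/funext => n; rewrite /series /= mulr_sumr.
exact: cvgMl_tmp.
Qed.

Lemma cvg_seriesMC (R : realType) (c : R[i]) (u : nat -> R[i]) (l : R[i]) :
  series u @ \oo --> l -> series (fun n => c * u n) @ \oo --> c * l.
Proof. exact: (@cvg_seriesM R[i] c u l). Qed.

Lemma is_cvg_seriesMC (R : realType) (c : R[i]) (u : nat -> R[i]) :
  cvgn (series u) -> cvgn (series (fun n => c * u n)).
Proof. by move=> cu; apply: cvgP (cvg_seriesMC cu). Qed.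

(* The E-valued Hardy space H^2(D) (x) E: an element is the sequence of Taylor
   coefficients of a function f(z) = \sum_n z^n a_n with \sum_n |a_n|^2 finite
   (see hardy_eval), and <f, g> = \sum_n <a_n, b_n>. *)
Section hardy.
Context {R : realType} {E : hilbertType R}.
Implicit Types a b : nat -> E.

Definition square_summable : set (nat -> E) :=
  [set a | cvgn (series (fun n => `|a n| ^+ 2 : R[i]))].

Definition hardy_pred : {pred nat -> E} := mem square_summable.

Fact hardy_submod_closed : submod_closed hardy_pred.
Proof.
split.
  apply: mem_set; apply: (@nneseries_is_cvgC _ _ 0) => n.
    by rewrite exprn_ge0.
  by rewrite /series /= big1// => i _; rewrite normr0 expr0n.
move=> c a b /set_mem /= ca /set_mem /= cb; apply: mem_set => /=.
apply: (@series_comparisonC _ _ _ ((fun n => 2 * `|c| ^+ 2 * `|a n| ^+ 2 : R[i]) +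
    (fun n => 2 * `|b n| ^+ 2 : R[i]))).
  move=> n; rewrite ger0_norm ?exprn_ge0//.
  have -> : ((fun n => 2 * `|c| ^+ 2 * `|a n| ^+ 2 : R[i]) +
      (fun n => 2 * `|b n| ^+ 2 : R[i])) n =
      2 * `|c *: a n| ^+ 2 + 2 * `|b n| ^+ 2.
    by rewrite normrZ exprMn [in RHS]mulrA.
  have h : `|(c *: a + b) n| ^+ 2 <= (`|c *: a n| + `|b n|) ^+ 2.
    by rewrite ler_sqr ?nnegrE ?addr_ge0//; exact: ler_normD.
  apply: le_trans h _.
  rewrite -subr_ge0.
  set x := `|_|; set y := `|_|.
  have -> : 2 * x ^+ 2 + 2 * y ^+ 2 - (x + y) ^+ 2 = (x - y) ^+ 2 by ring.
  by apply: real_exprn_even_ge0 => //; apply: realB; exact: normr_real.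
apply: is_cvg_seriesD; first by apply: is_cvg_seriesMC; exact: ca.
by apply: is_cvg_seriesMC; exact: cb.
Qed.
HB.instance Definition _ := GRing.isSubmodClosed.Build _ _ hardy_pred
  hardy_submod_closed.

Record hardy := Hardy_of {
  hardy_coef :> nat -> E;
  hardy_coefP : hardy_coef \in hardy_pred
}.

HB.instance Definition _ := [isSub for hardy_coef].
HB.instance Definition _ := [Choice of hardy by <:].
HB.instance Definition _ := [SubChoice_isSubLmodule of hardy by <:].
Implicit Types f g : hardy.

Definition hardy_dot f g : R[i] := limn (series (fun n => hdot (f n) (g n))).

Lemma is_cvg_hardy_sq f : cvgn (series (fun n => `|f n| ^+ 2 : R[i])).
Proof. exact/set_mem/hardy_coefP. Qed.

Lemma is_cvg_hardy_dot f g : cvgn (series (fun n => hdot (f n) (g n))).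
Proof.
apply: (@series_comparisonC _ _ _ ((fun n => `|f n| ^+ 2 : R[i]) + (fun n => `|g n| ^+ 2 : R[i]))).
  move=> n; apply: le_trans (hdot_CauchySchwarz _ _) _.
  have -> : ((fun n => `|f n| ^+ 2 : R[i]) + (fun n => `|g n| ^+ 2 : R[i])) n =
    `|f n| ^+ 2 + `|g n| ^+ 2 by [].
  rewrite -subr_ge0.
  set x := `|_|; set y := `|_|.
  have -> : x ^+ 2 + y ^+ 2 - x * y = (x - y) ^+ 2 + x * y by ring.
  apply: addr_ge0; last by apply: mulr_ge0; exact: normr_ge0.
  by apply: real_exprn_even_ge0 => //; apply: realB; exact: normr_real.
by apply: is_cvg_seriesD; exact: is_cvg_hardy_sq.
Qed.

Let dlin (c : R[i]) f g h :
  hardy_dot (c *: f + g) h = c * hardy_dot f h + hardy_dot g h.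
Proof.
apply/cvg_lim; first exact: norm_hausdorff.
have -> : series (fun n => hdot ((c *: f + g : hardy) n) (h n)) =
    series (fun n => c * hdot (f n) (h n)) + series (fun n => hdot (g n) (h n)).
  rewrite -seriesD; congr series; apply/funext => n; exact: hdot_linear.
apply: cvgD; last exact: is_cvg_hardy_dot.
by apply: cvg_seriesMC; exact: is_cvg_hardy_dot.
Qed.

Lemma cvg_conjC (u : nat -> R[i]) l : u @ \oo --> l -> (u n)^* @[n --> \oo] --> l^*.
Proof.
move=> /cvgrPdist_lt ul; apply/cvgrPdist_lt => e /ul.
by apply: filterS => n; rewrite -rmorphB /= norm_conjC.
Qed.

Let dC f g : hardy_dot f g = (hardy_dot g f)^*.
Proof.
apply/cvg_lim; first exact: norm_hausdorff.
have -> : series (fun n => hdot (f n) (g n)) =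
    (fun n => (series (fun n => hdot (g n) (f n)) n)^*).
  apply/funext => n; rewrite /series /= rmorph_sum /=.
  by apply: eq_bigr => i _; exact: hdotC.
by apply: cvg_conjC; exact: is_cvg_hardy_dot.
Qed.

Let dsqE f : hardy_dot f f = limn (series (fun n => `|f n| ^+ 2 : R[i])).
Proof.
by congr (limn (series _)); apply/funext => n; exact: hdot_norm.
Qed.

Let series_le_dsq f n : series (fun n => `|f n| ^+ 2 : R[i]) n <= hardy_dot f f.
Proof.
rewrite dsqE; apply: series_le_limC; last exact: is_cvg_hardy_sq.
by move=> k; rewrite exprn_ge0.
Qed.

Let dge0 f : 0 <= hardy_dot f f.
Proof. by have := series_le_dsq f 0; rewrite /series /= big_geq. Qed.

Let coef_le_dsq f n : `|f n| ^+ 2 <= hardy_dot f f.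
Proof.
apply: le_trans (series_le_dsq f n.+1).
rewrite /series /= big_nat_recr//= lerDr.
by apply: sumr_ge0 => i _; rewrite exprn_ge0.
Qed.

Let deq0 f : hardy_dot f f = 0 -> f = 0.
Proof.
move=> f0; apply/val_inj/funext => n /=; apply/eqP.
have /eqP : `|f n| ^+ 2 = 0.
  by apply/eqP; rewrite eq_le exprn_ge0// andbT -[leRHS]f0; exact: coef_le_dsq.
by rewrite expf_eq0 normr_eq0.
Qed.

Let nrm f : R[i] := sqrtC (hardy_dot f f).
Let nrmD f g : nrm (f + g) <= nrm f + nrm g.
Proof. exact: dot_triangle. Qed.
Let nrmZ (c : R[i]) f : nrm (c *: f) = `|c| * nrm f.
Proof. exact: sqrt_dotZ. Qed.
Let nrm0 f : nrm f = 0 -> f = 0.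
Proof. by move=> /eqP; rewrite sqrtC_eq0 => /eqP; exact: deq0. Qed.
HB.instance Definition _ := Lmodule_isNormed.Build R[i] hardy nrmD nrmZ nrm0.

Let dot_norm f : hardy_dot f f = `|f| ^+ 2.
Proof. by rewrite sqrtCK. Qed.

Lemma hardy_coef_le f n : `|f n| <= `|f|.
Proof. by rewrite -ler_sqr ?nnegrE// -dot_norm; exact: coef_le_dsq. Qed.

Let hardy_bnd a (M : R[i]) : 0 <= M ->
  (forall n, series (fun n => `|a n| ^+ 2 : R[i]) n <= M ^+ 2) ->
  exists f : hardy, f = a :> (nat -> E) /\ `|f| <= M.
Proof.
move=> M0 aM.
have ca : a \in hardy_pred.
  apply: mem_set; apply: (nneseries_is_cvgC _ aM) => n.
  by rewrite exprn_ge0.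
exists (Hardy_of ca); split => //.
rewrite -ler_sqr ?nnegrE// -dot_norm dsqE /= -subr_ge0.
apply: (@cvg_ge0C _ _ \oo _
  (fun n => M ^+ 2 - series (fun n => `|a n| ^+ 2 : R[i]) n)).
  by apply: nearW => n; rewrite subr_ge0.
apply: cvgB; first by apply: cvg_near_cst; exact: nearW.
exact: set_mem ca.
Qed.

Let hardy_complete (F : set_system hardy) : ProperFilter F -> cauchy F -> cvg F.
Proof.
move=> PF /cauchyP Fc.
have Fcoef n : cvg ((f : hardy) n @[f --> F]).
  apply/cauchy_cvgP/cauchyP => e e0; have [x Fx] := Fc e e0.
  exists (x n); suff : F ((fun f : hardy => f n) @^-1` ball (x n) e) by [].
  apply: filterS Fx => y; rewrite -!ball_normE /ball_ /=.
  exact/le_lt_trans/(hardy_coef_le (x - y)).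
pose l n := lim ((f : hardy) n @[f --> F]).
have lx (x : hardy) (e : R[i]) : 0 < e -> F (ball x e) ->
    exists f : hardy, f = (fun n => l n - x n) :> (nat -> E) /\ `|f| <= e.
  move=> e0 Fx; apply: hardy_bnd => [|N]; first exact: ltW.
  rewrite -subr_ge0.
  apply: (@cvg_ge0C _ _ F _ (fun f : hardy =>
      e ^+ 2 - series (fun n => `|f n - x n| ^+ 2 : R[i]) N)).
    apply: filterS Fx => y; rewrite -ball_normE /ball_ /= distrC => xy.
    rewrite subr_ge0; apply: le_trans (series_le_dsq (y - x) N) _.
    by rewrite dot_norm ler_sqr ?nnegrE// ltW.
  apply: cvgB; first by apply: cvg_near_cst; exact: nearW.
  rewrite /series /=; apply: cvg_big => [|i _]; first exact: add_continuous.
  apply: cvgM; apply: cvg_norm; apply: cvgB; first exact: Fcoef.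
    by apply: cvg_near_cst; exact: nearW.
  exact: Fcoef.
  by apply: cvg_near_cst; exact: nearW.
have [x0 Fx0] := Fc 1 ltr01.
have [f [fE _]] := lx x0 1 ltr01 Fx0.
apply/cvg_ex; exists (f + x0); apply/(@cvgrPdist_lt _ _ _ F _ id) => e e0.
have e20 : 0 < e / 2 by rewrite divr_gt0.
have [x Fx] := Fc _ e20.
have [g [gE gle]] := lx x _ e20 Fx.
have -> : f + x0 = g + x.
  apply/val_inj/funext => n.
  suff : f n + x0 n = g n + x n by [].
  by rewrite fE gE !subrK.
apply: filterS Fx => y; rewrite -ball_normE /ball_ /= => xy.
rewrite -addrA (le_lt_trans (ler_normD _ _))// [ltRHS]splitr.
exact: ler_ltD.
Qed.
HB.instance Definition _ := Uniform_isComplete.Build hardy hardy_complete.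
HB.instance Definition _ := CompleteNormedModule_isHilbert.Build R hardy
  dlin dC dot_norm.

End hardy.

Arguments hardy {R} E.

HB.instance Definition _ (K : numFieldType) (V : normedModType K) :=
  isContinuous.Build V V idfun (fun x : V => @cvg_id V (nbhs x)).

Section hardy_operators.
Context {R : realType}.

(* z |-> hardy_eval f z is the E-valued function on the disc whose Taylor
   coefficients are stored in f. *)
Definition hardy_eval (E : hilbertType R) (f : hardy E) (z : R[i]) : E :=
  limn (series (fun n => z ^+ n *: f n)).

Lemma is_cvg_hardy_eval (E : hilbertType R) (f : hardy E) (z : R[i]) :
  `|z| < 1 -> cvgn (series (fun n => z ^+ n *: f n)).
Proof.
move=> z1; apply: (@series_comparisonC _ _ _ (fun n => `|f| * `|z| ^+ n)).
  by move=> n; rewrite normrZ normrX mulrC ler_wpM2r ?exprn_ge0// hardy_coef_le.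
apply: is_cvg_seriesMC; apply: (@nneseries_is_cvgC _ _ (1 - `|z|)^-1) => n.
  by rewrite exprn_ge0.
rewrite -[leRHS]mul1r ler_pdivlMr ?subr_gt0// mulrC /series /= big_mkord.
by rewrite -opprB mulNr -subrX1 opprB gerBl exprn_ge0.
Qed.

Fact hardy_map_subproof (E E' : hilbertType R) (A : boundedOp E E')
  (f : hardy E) : (fun n => A (f n)) \in hardy_pred.
Proof.
have [M M0 AM] := boundedOp_le A; apply: mem_set => /=.
apply: (@series_comparisonC _ _ _ (fun n => M ^+ 2 * `|f n| ^+ 2)).
  move=> n; rewrite ger0_norm ?exprn_ge0// -exprMn ler_sqr ?nnegrE ?mulr_ge0//.
  exact: AM.
by apply: is_cvg_seriesMC; exact: is_cvg_hardy_sq.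
Qed.

Definition id_tensor (E E' : hilbertType R) (A : boundedOp E E')
  (f : hardy E) : hardy E' := Hardy_of (hardy_map_subproof A f).

Fact hardy_shift_subproof (E : hilbertType R) (f : hardy E) :
  (fun n => if n is m.+1 then f m else 0) \in hardy_pred.
Proof.
apply: mem_set; apply: (@nneseries_is_cvgC _ _ (`|f| ^+ 2)) => n.
  by rewrite exprn_ge0.
case: n => [|n]; first by rewrite /series /= big_geq// exprn_ge0.
rewrite /series /= big_nat_recl//= normr0 expr0n add0r -hdot_norm.
have -> : hdot f f = limn (series (fun n => `|f n| ^+ 2 : R[i])).
  by congr (limn (series _)); apply/funext => k; exact: hdot_norm.
apply: (@series_le_limC _ (fun n => `|f n| ^+ 2 : R[i])).
  by move=> k; rewrite exprn_ge0.
exact: is_cvg_hardy_sq.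
Qed.

Definition hardy_shift (E : hilbertType R) (f : hardy E) : hardy E :=
  Hardy_of (hardy_shift_subproof f).

Definition Mz_tensor (E E' : hilbertType R) (A : boundedOp E E')
  (f : hardy E) : hardy E' := hardy_shift (id_tensor A f).

Lemma hardy_eval_id_tensor (E E' : hilbertType R) (A : boundedOp E E')
  (f : hardy E) (z : R[i]) : `|z| < 1 ->
  hardy_eval (id_tensor A f) z = A (hardy_eval f z).
Proof.
move=> z1; apply/cvg_lim; first exact: norm_hausdorff.
have -> : series (fun n => z ^+ n *: id_tensor A f n) =
    A \o series (fun n => z ^+ n *: f n).
  apply/funext => n; rewrite /series /= linear_sum; apply: eq_bigr => i _.
  by rewrite linearZ.
by apply: continuous_cvg; [exact: cts_fun|exact: is_cvg_hardy_eval].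
Qed.

Lemma hardy_eval_shift (E : hilbertType R) (f : hardy E) (z : R[i]) :
  `|z| < 1 -> hardy_eval (hardy_shift f) z = z *: hardy_eval f z.
Proof.
move=> z1; apply/cvg_lim; first exact: norm_hausdorff.
rewrite -cvg_shiftS /=.
have -> : (fun n => series (fun n => z ^+ n *: hardy_shift f n) n.+1) =
    (fun n => z *: series (fun n => z ^+ n *: f n) n).
  apply/funext => n; rewrite /series /= big_nat_recl//= scaler0 add0r.
  by rewrite scaler_sumr; apply: eq_bigr => i _; rewrite exprS scalerA.
by apply: cvgZl_tmp; exact: is_cvg_hardy_eval.
Qed.

Lemma hardy_eval_Mz_tensor (E E' : hilbertType R) (A : boundedOp E E')
  (f : hardy E) (z : R[i]) : `|z| < 1 ->
  hardy_eval (Mz_tensor A f) z = z *: A (hardy_eval f z).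
Proof. by move=> z1; rewrite hardy_eval_shift// hardy_eval_id_tensor. Qed.

End hardy_operators.

Lemma closure_normP (K : numFieldType) (V : normedModType K) (A : set V) (x : V) :
  closure A x <-> forall e : K, 0 < e -> exists2 y, A y & `|x - y| < e.
Proof.
split=> [clA e e0|xA B /nbhs_normP[e /= e0 eB]].
  have [y [Ay xy]] := clA _ (nbhsx_ballx x e e0).
  by exists y => //; move: xy; rewrite -ball_normE.
by have [y Ay xy] := xA e e0; exists y; split => //; exact: eB.
Qed.

Section operators.
Context {R : realType}.
Implicit Types H K : hilbertType R.

(* [get A] picks a point of A, and a default one when A is empty.  In each use
   below the set has exactly one element for the arguments that matter: T
   bounded for [adjoint] (Riesz), A positive for [op_sqrt], T boundedly
   invertible for [op_inv], W closed for [orth_proj]. *)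
Definition adjoint H K (T : boundedOp H K) : boundedOp K H :=
  get [set A : boundedOp K H | forall x y, hdot (T x) y = hdot x (A y)].

Definition positive_op H (T : boundedOp H H) := forall x, 0 <= hdot (T x) x.

Definition op_sqrt H (A : H -> H) : boundedOp H H :=
  get [set D : boundedOp H H | positive_op D /\ forall x, D (D x) = A x].

Definition op_inv H (T : H -> H) : boundedOp H H :=
  get [set B : boundedOp H H | cancel T B /\ cancel B T].

(* Norms take values in R[i], hence the real parts. *)
Definition op_norm H K (T : H -> K) : R :=
  sup [set complex.Re `|T x| | x in [set x | `|x| <= 1]].

Definition orthogonal_to H (A : set H) : set H :=
  [set x | forall y, A y -> hdot x y = 0].

Fact orthogonal_to0 H (A : set H) : orthogonal_to A 0.
Proof. by move=> y _; exact: (dot0l (@hdot_linear R H)). Qed.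

Fact orthogonal_toP H (A : set H) (a : R[i]) (u v : H) :
  orthogonal_to A u -> orthogonal_to A v -> orthogonal_to A (a *: u + v).
Proof.
by move=> uA vA y Ay; rewrite hdot_linear uA// vA// mulr0 addr0.
Qed.

Fact orthogonal_to_closed H (A : set H) : closed (orthogonal_to A).
Proof.
move=> x /closure_normP clx y Ay; apply/eqP; apply/negPn/negP => xy0.
have y1 : 0 < `|y| + 1 by rewrite ltr_wpDl.
have [|u uA] := clx (`|hdot x y| / (`|y| + 1)).
  by rewrite divr_gt0// normr_gt0.
rewrite ltr_pdivlMr// => /lt_geF/negP; apply.
have -> : hdot x y = hdot (x - u) y.
  by rewrite (dotDl (@hdot_linear R H)) -scaleN1r (dotZl (@hdot_linear R H)) uA// mulr0 addr0.
by apply: le_trans (hdot_CauchySchwarz _ _) _; rewrite ler_wpM2l// lerDl.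
Qed.

Definition orthogonal_complement H (A : set H) : closed_subspace H :=
  @ClosedSubspace R H (orthogonal_to A) (@orthogonal_to0 H A) (@orthogonal_toP H A)
    (@orthogonal_to_closed H A).

Section closed_range.
Context H K (T : boundedOp H K).

Fact closed_range0 : closure (range T) 0.
Proof. by apply: subset_closure; exists 0 => //; rewrite linear0. Qed.

Fact closed_rangeP (a : R[i]) (u v : K) :
  closure (range T) u -> closure (range T) v -> closure (range T) (a *: u + v).
Proof.
move=> /closure_normP ru /closure_normP rv; apply/closure_normP => e e0.
have a1 : 0 < `|a| + 1 by rewrite ltr_wpDl.
have e2 : 0 < e / 2 by rewrite divr_gt0.
have [|_ [x _ <-] ux] := ru (e / 2 / (`|a| + 1)); first by rewrite divr_gt0.
have [_ [y _ <-] vy] := rv _ e2.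
exists (a *: T x + T y); first by exists (a *: x + y) => //; rewrite linearP.
rewrite opprD addrACA -scalerBr (le_lt_trans (ler_normD _ _))// [ltRHS]splitr.
apply: ler_ltD => //; rewrite normrZ.
have /ltW := ux; rewrite ler_pdivlMr// mulrC; apply: le_trans.
by rewrite ler_wpM2r// lerDl.
Qed.

Definition closed_range : closed_subspace K :=
  @ClosedSubspace R K (closure (range T)) closed_range0 closed_rangeP (@closed_closure _ _).

Fact closed_range_subproof x : T x \in subspace_pred closed_range.
Proof. by apply/mem_set/subset_closure; exists x. Qed.

Definition to_closed_range (x : H) : subHilbert closed_range :=
  Subspace_of (closed_range_subproof x).

End closed_range.

Definition orth_proj H (W : closed_subspace H) (x : H) : subHilbert W :=
  get [set y : subHilbert W | orthogonal_to (subspace_set W) (x - \val y)].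

End operators.

Section gamma_contraction.
Context {R : realType}.
Implicit Types H : hilbertType R.

Definition Gamma_set : set (R[i] * R[i]) :=
  [set w | exists z1 z2 : R[i],
     [/\ `|z1| <= 1, `|z2| <= 1 & w = (z1 + z2, z1 * z2)]].

(* p = \sum_(i, j) p`_i`_j X^i Y^j is evaluated at X = w.1 and Y = w.2 in
   [horner2], and at X = S and Y = P in [horner2_op]. *)
Definition horner2 (p : {poly {poly R[i]}}) (w : R[i] * R[i]) : R[i] :=
  p.[w.1%:P].[w.2].

Definition horner2_op H (p : {poly {poly R[i]}}) (S P : H -> H) (x : H) : H :=
  \sum_(i < size p) \sum_(j < size p`_i) p`_i`_j *: iter i S (iter j P x).

(* Gamma_set is polynomially convex, so being a spectral set for (S, P) amounts
   to the von Neumann inequality for polynomials. *)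
Definition Gamma_contraction H (S P : boundedOp H H) :=
  (forall x, S (P x) = P (S x)) /\
  forall p : {poly {poly R[i]}},
    op_norm (horner2_op p S P) <= sup [set complex.Re `|horner2 p w| | w in Gamma_set].

Definition pure_op H (P : boundedOp H H) :=
  forall x : H, iter n (adjoint P) x @[n --> \oo] --> (0 : H).

(* D_P; the operator D_{P^*} is defect (adjoint P), as P^** = P. *)
Definition defect H (P : boundedOp H H) : boundedOp H H :=
  op_sqrt (fun x => x - adjoint P (P x)).

Definition defect_space H (P : boundedOp H H) : closed_subspace H :=
  closed_range (defect P).

End gamma_contraction.

Notation defectType P := (subHilbert (defect_space P)).

Section functional_model.
Context {R : realType}.
Implicit Types H : hilbertType R.

(* S - S^* P = D_P F D_P, where the right-hand D_P is to_closed_range (defect P),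
   the operator with values in the defect space. *)
Definition fundamental_operator H (S P : boundedOp H H)
    (F : boundedOp (defectType P) (defectType P)) :=
  forall x, S x - adjoint S (P x) =
            defect P (\val (F (to_closed_range (defect P) x))).

(* Theta_P(z) xi, seen in H; it lies in the defect space of P^*. *)
Definition char_fun H (P : boundedOp H H) (z : R[i]) (xi : defectType P) : H :=
  - P (\val xi) + z *: defect (adjoint P)
      (op_inv (fun x => x - z *: adjoint P x) (defect P (\val xi))).

Arguments char_fun {H} P z xi.

(* g = M_{Theta_P} f, as functions on the open unit disc. *)
Definition char_mult H (P : boundedOp H H) (f : hardy (defectType P))
    (g : hardy (defectType (adjoint P))) :=
  forall z : R[i], `|z| < 1 -> \val (hardy_eval g z) =
    char_fun P z (hardy_eval f z).

Arguments char_mult {H} P f g.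

(* H_P; a set and its closure have the same orthogonal complement. *)
Definition model_space H (P : boundedOp H H) :=
  orthogonal_complement
    [set g : hardy (defectType (adjoint P)) |
      exists f : hardy (defectType P), char_mult P f g].

Definition model_S H (P : boundedOp H H)
    (F : boundedOp (defectType (adjoint P)) (defectType (adjoint P)))
    (h : subHilbert (model_space P)) : subHilbert (model_space P) :=
  orth_proj (model_space P) (id_tensor (adjoint F) (\val h) + Mz_tensor F (\val h)).

Definition model_P H (P : boundedOp H H)
    (h : subHilbert (model_space P)) : subHilbert (model_space P) :=
  orth_proj (model_space P) (Mz_tensor idfun (\val h)).

Definition unitary_op H (K : hilbertType R) (U : boundedOp H K) :=
  (forall x y, hdot (U x) (U y) = hdot x y) /\ forall y, exists x, U x = y.

End functional_model.

Arguments fundamental_operator {R H} S P F.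
Arguments char_fun {R H} P z xi.
Arguments char_mult {R H} P f g.
Arguments model_S {R H} P F h.
Arguments model_P {R H} P h.

(* Main.v *)
(** Write Q = P^*, D = D_P, D' = D_{P^*}.  As P is pure, the Poisson map
    W h = \sum_n z^n D' Q^n h is an isometry of H into H^2 (x) D_{P^*}; it turns
    Q into the backward shift, and D' S^* = F D' + F^* D' Q turns S^* into the
    adjoint of I (x) F^* + M_z (x) F.  So everything reduces to ran W = H_P.

    For this, g = M_Theta f is read as the output of a linear system with state
    x: x_0 = 0, x_{n+1} = Q x_n + D f_n, g_n = D' x_n - P f_n.  The block operator
    [Q D; D' -P] is unitary, so the energy |x_N|^2 + \sum_{n<N} |g_n|^2 equals
    \sum_{n<N} |f_n|^2.  Then \sum_{n<N} P^n D' g_n = - P^N x_N, which tends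
    weakly to 0 by purity: ran W is orthogonal to ran M_Theta.  Conversely, if
    W^* g = 0, running the system backwards from x_n = W^* (backward shift)^n g
    gives x_0 = 0 and an input f with g = M_Theta f. *)

Require Import Defs.
From mathcomp Require Import all_boot all_order all_algebra.
From mathcomp Require Import all_classical all_reals topology normedtype.
From mathcomp Require Import sequences complex ring lra.
From HB Require Import structures.
Set Implicit Arguments.
Unset Strict Implicit.
Unset Printing Implicit Defensive.
Import Order.TTheory GRing.Theory Num.Theory.
Import numFieldNormedType.Exports numFieldTopology.Exports.
Local Open Scope classical_set_scope.
Local Open Scope ring_scope.

(** * Hilbert spaces: projections and adjoints *)

Section hdot_theory.
Context {R : realType} {H : hilbertType R}.
Implicit Types u v w : H.

Lemma hdot0l w : hdot 0 w = 0.
Proof. exact: (dot0l (@hdot_linear R H)). Qed.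

Lemma hdotDl u v w : hdot (u + v) w = hdot u w + hdot v w.
Proof. exact: (dotDl (@hdot_linear R H)). Qed.

Lemma hdotZl (a : R[i]) u w : hdot (a *: u) w = a * hdot u w.
Proof. exact: (dotZl (@hdot_linear R H)). Qed.

Lemma hdotNl u w : hdot (- u) w = - hdot u w.
Proof. by rewrite -scaleN1r hdotZl mulN1r. Qed.

Lemma hdotBl u v w : hdot (u - v) w = hdot u w - hdot v w.
Proof. by rewrite hdotDl hdotNl. Qed.

Lemma hdot0r w : hdot w 0 = 0.
Proof. by rewrite hdotC hdot0l rmorph0. Qed.

Lemma hdotDr u v w : hdot u (v + w) = hdot u v + hdot u w.
Proof. exact: (dotDr (@hdot_linear R H) (@hdotC R H)). Qed.

Lemma hdotZr (a : R[i]) u w : hdot u (a *: w) = a^* * hdot u w.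
Proof. exact: (dotZr (@hdot_linear R H) (@hdotC R H)). Qed.

Lemma hdotNr u w : hdot u (- w) = - hdot u w.
Proof. by rewrite hdotC hdotNl rmorphN /= -hdotC. Qed.

Lemma hdotBr u v w : hdot u (v - w) = hdot u v - hdot u w.
Proof. by rewrite hdotDr hdotNr. Qed.

Lemma hdot_ge0 u : 0 <= hdot u u.
Proof. by rewrite hdot_norm exprn_ge0. Qed.

Lemma hdot_eq0 u : hdot u u = 0 -> u = 0.
Proof. by move=> /eqP; rewrite hdot_norm expf_eq0 normr_eq0 => /eqP. Qed.

Lemma hdot_injr u v : (forall w, hdot w u = hdot w v) -> u = v.
Proof.
by move=> uv; apply/subr0_eq/hdot_eq0; rewrite hdotBr uv subrr.
Qed.

Lemma parallelogram u v :
  `|u + v| ^+ 2 + `|u - v| ^+ 2 = 2 * `|u| ^+ 2 + 2 * `|v| ^+ 2 :> R[i].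
Proof.
rewrite -!hdot_norm !(hdotDl, hdotDr, hdotNl, hdotNr); ring.
Qed.

Lemma sqr_norm_hdotD u v :
  `|u + v| ^+ 2 = `|u| ^+ 2 + hdot u v + hdot v u + `|v| ^+ 2 :> R[i].
Proof. rewrite -!hdot_norm !(hdotDl, hdotDr); ring. Qed.

Lemma sqr_norm_hdotB u v :
  `|u - v| ^+ 2 = `|u| ^+ 2 - hdot u v - hdot v u + `|v| ^+ 2 :> R[i].
Proof. rewrite -!hdot_norm !(hdotBl, hdotBr); ring. Qed.

Lemma cvg_hdotl (T : Type) (F : set_system T) {FF : Filter F} (f : T -> H) (l w : H) :
  f x @[x --> F] --> l -> hdot (f x) w @[x --> F] --> hdot l w.
Proof.
move=> /cvgrPdist_lt fl; apply/cvgrPdist_lt => e e0.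
have w1 : 0 < `|w| + 1 by rewrite ltr_wpDl.
have /fl : 0 < e / (`|w| + 1) by rewrite divr_gt0.
apply: filterS => x; rewrite ltr_pdivlMr// => lx.
rewrite -hdotBl; apply: le_lt_trans (hdot_CauchySchwarz _ _) _.
by apply: le_lt_trans lx; rewrite ler_wpM2l// lerDl.
Qed.

End hdot_theory.

Section projection.
Context {R : realType} {H : hilbertType R}.

(** Norms live in [R[i]]; the squared norm is moved to [R], where infima and [lra] are available. *)
Let sqn (u : H) : R := complex.Re (`|u| ^+ 2).

Let sqnE u : `|u| ^+ 2 = ((sqn u)%:C)%C.
Proof. by apply: ge0_ReE; rewrite exprn_ge0. Qed.

Let sqn_ge0 u : 0 <= sqn u.
Proof. by rewrite -lecR -sqnE exprn_ge0. Qed.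

(** A minimizing sequence for the distance from [x] to [W] is Cauchy by the parallelogram law;
    comparing its limit with its translates along [W] gives orthogonality. *)
Lemma projection_exists (W : closed_subspace H) (x : H) :
  exists2 y, subspace_set W y & orthogonal_to (subspace_set W) (x - y).
Proof.
pose E := [set sqn (x - w) | w in subspace_set W].
have Einf : has_inf E.
  split; first by exists (sqn (x - 0)), 0 => //; exact: subspace_set0.
  by exists 0 => _ [w _ <-].
have infE w : subspace_set W w -> inf E <= sqn (x - w).
  by move=> Ww; apply: (ge_inf (proj2 Einf)); exists w.
have /choice[w wP] n : exists w, subspace_set W w /\ sqn (x - w) < inf E + n.+1%:R^-1.
  have [_ [w Ww <-] lt_w] : exists2 e, E e & e < inf E + n.+1%:R^-1.
    by apply: inf_adherent => //; rewrite invr_gt0 ltr0n.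
  by exists w.
(* The midpoint of [w m] and [w n] lies in [W], so its squared distance to [x] is at least [inf E];
   the parallelogram law then leaves at most [2 / m.+1 + 2 / n.+1]. *)
have dw m n : (m <= n)%N -> sqn (w n - w m) <= 4 * m.+1%:R^-1.
  move=> mn.
  have [Wm ltm] := wP m; have [Wn ltn] := wP n.
  have Wmid : subspace_set W (2^-1 *: w m + 2^-1 *: w n).
    apply: subspace_setP => //; rewrite -[_ *: _]addr0.
    by apply: subspace_setP => //; exact: subspace_set0.
  have := parallelogram (x - w m) (x - w n).
  have -> : x - w m + (x - w n) = 2 *: (x - (2^-1 *: w m + 2^-1 *: w n)).
    rewrite scalerBr scalerDr !scalerA divff ?pnatr_eq0// !scale1r.
    by rewrite scaler_nat mulr2n opprD addrACA.
  have -> : x - w m - (x - w n) = w n - w m.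
    by rewrite opprB addrC addrA subrK.
  rewrite normrZ exprMn ger0_norm// !sqnE => eq4.
  have {}eq4 : 4 * sqn (x - (2^-1 *: w m + 2^-1 *: w n)) + sqn (w n - w m) =
      2 * sqn (x - w m) + 2 * sqn (x - w n).
    apply: (@complexI R); rewrite !rmorphD !rmorphM /= !rmorph_nat -eq4.
    by rewrite -natrX.
  have := infE _ Wmid.
  have : n.+1%:R^-1 <= m.+1%:R^-1 :> R by rewrite lef_pV2 ?posrE ?ltr0n// ler_nat.
  by move: ltm ltn eq4; set a := m.+1%:R^-1; set b := n.+1%:R^-1; lra.
have /cvg_ex[y wy] : cvg (w n @[n --> \oo]).
  apply/cauchy_cvgP/cauchyP => e e0.
  have eE : e = ((complex.Re e)%:C)%C by apply: ge0_ReE; exact: ltW.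
  have r0 : 0 < complex.Re e by rewrite -ltcR -eE.
  pose m := Num.truncn (4 / complex.Re e ^+ 2).
  have mP : 4 * m.+1%:R^-1 < complex.Re e ^+ 2.
    rewrite ltr_pdivrMr ?ltr0n// mulrC -ltr_pdivrMr ?exprn_gt0//.
    by rewrite -truncn_lt_nat// divr_ge0// exprn_ge0// ltW.
  exists (w m); exists m => // n /= mn.
  rewrite -ball_normE /ball_ /= distrC -ltr_sqr ?nnegrE// ?ltW//.
  rewrite sqnE eE -rmorphXn /= ltcR; apply: le_lt_trans mP; exact: dw.
have Wy : subspace_set W y.
  apply: (@closed_cvg _ _ \oo _ _ _ _ _ _ wy); first exact: subspace_closed.
  by apply: nearW => n; exact: (wP n).1.
have sqn_xy : sqn (x - y) <= inf E.
  apply: (@cvgr_to_le _ \oo _ _ (fun n => sqn (x - w n) - n.+1%:R^-1)).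
    rewrite -[X in _ --> X]subr0; apply: cvgB; last exact: cvg_harmonic.
    apply: cvg_Re; apply: cvgM; apply: cvg_norm; apply: cvgB => //; exact: cvg_cst.
  by apply: nearW => n; rewrite lerBlDr ltW// (wP n).2.
exists y => // v Wv.
have : forall a, `|x - y| ^+ 2 <= `|x - y - a *: v| ^+ 2.
  move=> a; rewrite !sqnE lecR; apply: le_trans sqn_xy _.
  rewrite -addrA -opprD [y + _]addrC.
  by apply: infE; exact: subspace_setP.
move: (x - y) => u min_u.
have [->|v0] := eqVneq v 0; first by rewrite hdot0r.
have vv0 : hdot v v != 0 by apply: contra_neq v0; exact: hdot_eq0.
(* This coefficient minimizes the norm of [u - a *: v]; the squared norm drops by
   [|<u, v>|^2 / <v, v>], which must therefore vanish. *)
pose a := hdot u v / hdot v v.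
have := min_u a.
have ac : a^* = (hdot u v)^* / hdot v v.
  by rewrite /a rmorphM /= fmorphV /= -(hdotC v v).
have -> : `|u - a *: v| ^+ 2 = `|u| ^+ 2 - `|hdot u v| ^+ 2 / hdot v v.
  rewrite -!hdot_norm !(hdotBl, hdotBr) !(hdotZl, hdotZr) ac (hdotC v u).
  by rewrite normCK /a; field.
rewrite lerDl oppr_ge0 => uv0; apply/eqP; rewrite -normr_eq0 -sqrf_eq0.
have : `|hdot u v| ^+ 2 / hdot v v == 0.
  by rewrite eq_le uv0 divr_ge0 ?exprn_ge0// hdot_ge0.
by rewrite mulf_eq0 invr_eq0 (negbTE vv0) orbF.
Qed.

End projection.

Lemma boundedOp_of (K : numFieldType) (U V : normedModType K) (f : U -> V) (M : K) :
  linear f -> 0 <= M -> (forall x, `|f x| <= M * `|x|) ->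
  exists A : boundedOp U V, A =1 f.
Proof.
move=> flin M0 fM.
pose L := GRing.isLinear.Build K U V *:%R f flin.
have fcts : continuous f.
  move=> x; apply/cvgrPdist_lt => e e0.
  have M1 : 0 < M + 1 by rewrite ltr_wpDl.
  apply/nbhs_normP; exists (e / (M + 1)) => /=; first by rewrite divr_gt0.
  move=> y; rewrite /ball_ /= ltr_pdivlMr// => xy.
  have -> : f x - f y = f (x - y).
    by rewrite addrC -scaleN1r -flin scaleN1r addrC.
  apply: le_lt_trans (fM _) _; apply: le_lt_trans xy; rewrite mulrC.
  by rewrite ler_wpM2l// lerDl.
pose C := isContinuous.Build U V f fcts.
pose A : boundedOp U V := HB.pack f L C.
by exists A.
Qed.

Section adjoint_theory.
Context {R : realType}.
Implicit Types H K : hilbertType R.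

(** The kernel of [phi] is closed. If [phi] is nonzero, projecting on the kernel yields a vector [z]
    orthogonal to it with [phi z != 0], and [x - (phi x / phi z) *: z], being in the kernel, is
    orthogonal to [z]. *)
Lemma Riesz_representation H (phi : H -> R[i]) (M : R[i]) :
  (forall (a : R[i]) x y, phi (a *: x + y) = a * phi x + phi y) ->
  0 <= M -> (forall x, `|phi x| <= M * `|x|) ->
  exists v, forall x, phi x = hdot x v.
Proof.
move=> lin M0 phiM.
have phi0 : phi 0 = 0.
  by have := lin (-1) 0 0; rewrite scaler0 addr0 mulN1r addNr.
have phiB x y : phi (x - y) = phi x - phi y.
  by rewrite addrC -scaleN1r lin mulN1r addrC.
have ker_closed : closed [set x | phi x = 0].
  move=> x /closure_normP clx /=; apply/eqP/negPn/negP => phix.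
  have M1 : 0 < M + 1 by rewrite ltr_wpDl.
  have [|y /= y0] := clx (`|phi x| / (M + 1)); first by rewrite divr_gt0 ?normr_gt0.
  rewrite ltr_pdivlMr// => /lt_geF/negP; apply.
  rewrite -[phi x]subr0 -y0 -phiB; apply: le_trans (phiM _) _.
  by rewrite mulrC ler_wpM2l// lerDl.
have kerP (a : R[i]) u v : phi u = 0 -> phi v = 0 -> phi (a *: u + v) = 0.
  by move=> u0 v0; rewrite lin u0 v0 mulr0 addr0.
pose W := @ClosedSubspace R H [set x | phi x = 0] phi0 kerP ker_closed.
have [all0|] := pselect (forall x, phi x = 0).
  by exists 0 => x; rewrite all0 hdot0r.
move=> /existsNP[x0 /eqP phix0].
have [p pW orth] := projection_exists W x0.
have {orth} : forall y, phi y = 0 -> hdot (x0 - p) y = 0 by [].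
have : phi (x0 - p) != 0 by rewrite phiB (pW : phi p = 0) subr0.
move: (x0 - p) => z phiz zW.
have zz0 : hdot z z != 0.
  by apply: contra_neq phiz => /hdot_eq0 ->.
exists (((phi z)^* / hdot z z) *: z) => x.
have : hdot (x - (phi x / phi z) *: z) z = 0.
  rewrite hdotC zW ?rmorph0// phiB -[_ *: z]addr0 lin phi0 addr0.
  by rewrite divfK// subrr.
rewrite hdotBl hdotZl => /subr0_eq xz.
rewrite hdotZr xz rmorphM /= conjCK fmorphV /= -(hdotC z z).
by field; rewrite phiz zz0.
Qed.

(** Riesz gives [A y] for each [y]; the bound comes from [|A y|^2 = <T (A y), y>]. *)
Lemma adjoint_exists H K (T : boundedOp H K) :
  exists A : boundedOp K H, forall x y, hdot (T x) y = hdot x (A y).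
Proof.
have [M M0 TM] := boundedOp_le T.
have /choice[A AP] y : exists v, forall x, hdot (T x) y = hdot x v.
  apply: (@Riesz_representation _ _ (M * `|y|)).
  - by move=> a x x'; rewrite linearP hdot_linear.
  - by rewrite mulr_ge0.
  - move=> x; apply: le_trans (hdot_CauchySchwarz _ _) _.
    by rewrite mulrAC ler_wpM2r.
have Alin : linear A.
  move=> a u v; apply: hdot_injr => w.
  by rewrite hdotDr hdotZr -!AP hdotDr hdotZr.
have AM y : `|A y| <= M * `|y|.
  have [->|Ay0] := eqVneq (A y) 0; first by rewrite normr0 mulr_ge0.
  rewrite -(ler_pM2r (_ : 0 < `|A y|)) ?normr_gt0// -expr2.
  rewrite -[leLHS]ger0_norm ?exprn_ge0// -hdot_norm -AP.
  apply: le_trans (hdot_CauchySchwarz _ _) _.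
  by rewrite mulrAC ler_wpM2r.
have [B BA] := boundedOp_of Alin M0 AM.
by exists B => x y; rewrite BA AP.
Qed.

Lemma adjointP H K (T : boundedOp H K) x y : hdot (T x) y = hdot x (adjoint T y).
Proof.
have [A AP] := adjoint_exists T.
have := @getI _ [set A : boundedOp K H | forall x y, hdot (T x) y = hdot x (A y)] A AP.
exact.
Qed.

Lemma adjointPr H K (T : boundedOp H K) x y : hdot x (T y) = hdot (adjoint T x) y.
Proof. by rewrite hdotC adjointP -hdotC. Qed.

Lemma adjointK H K (T : boundedOp H K) : adjoint (adjoint T) =1 T.
Proof. by move=> x; apply: hdot_injr => w; rewrite -adjointP -adjointPr. Qed.

Lemma adjoint_commute H (S T : boundedOp H H) : (forall x, S (T x) = T (S x)) ->
  forall x, adjoint S (adjoint T x) = adjoint T (adjoint S x).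
Proof. by move=> ST x; apply: hdot_injr => w; rewrite -!adjointP ST. Qed.

End adjoint_theory.

(** * Square roots and defect operators *)

Section positive_operators.
Context {R : realType} {H : hilbertType R}.
Implicit Types D : boundedOp H H.

(** Polarization: the quadratic form of [D] is real at [x + y] and at [x + 'i *: y]. *)
Lemma positive_op_sym D : positive_op D -> forall x y, hdot (D x) y = hdot x (D y).
Proof.
move=> Dpos x y.
have Dreal z : (hdot (D z) z)^* = hdot (D z) z by apply/CrealP/ger0_real/Dpos.
rewrite [RHS]hdotC; set a := hdot (D x) y; set b := hdot (D y) x.
have e1 : a^* + b^* = a + b.
  have := Dreal (x + y); rewrite linearD !(hdotDl, hdotDr) !rmorphD /= !Dreal -/a -/b => h.
  have -> : a^* + b^* = hdot (D x) x + a^* + (b^* + hdot (D y) y) -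
      (hdot (D x) x + hdot (D y) y) by ring.
  rewrite h; ring.
have e2 : a^* - b^* = b - a.
  have := Dreal (x + 'i *: y).
  rewrite linearD linearZ /= !(hdotDl, hdotDr) !(hdotZl, hdotZr) !rmorphD /=.
  rewrite !rmorphM /= !Dreal -/a -/b conjCi !rmorphN /= conjCi => h.
  apply: (@mulfI _ 'i); first exact: neq0Ci.
  have -> : 'i * (a^* - b^*) = hdot (D x) x + - - 'i * a^* +
      (- 'i * b^* + - 'i * (- - 'i * hdot (D y) y)) -
      (hdot (D x) x - 'i * 'i * hdot (D y) y) by ring.
  rewrite h; ring.
apply: (@mulfI _ 2); first by rewrite pnatr_eq0.
have -> : 2 * b^* = (a^* + b^*) - (a^* - b^*) by ring.
rewrite e1 e2; ring.
Qed.

(** At [x + t *: D x] the form equals [2 t s + t^2 c], with [s = |D x|^2]; for small negative [t]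
    this would be negative unless [s = 0]. *)
Lemma positive_op_eq0 D x : positive_op D -> hdot (D x) x = 0 -> D x = 0.
Proof.
move=> Dpos Dxx; have Dsym := positive_op_sym Dpos.
pose s := hdot (D x) (D x); pose c := hdot (D (D x)) (D x).
have c0 : 0 <= c by exact: Dpos.
have s0 : 0 <= s by exact: hdot_ge0.
have c1 : 0 < c + 1 by rewrite ltr_wpDl.
(* The minimum is at [- s / c]; the added 1 covers [c = 0]. *)
pose t := - (s / (c + 1)).
have tc : t^* = t.
  by apply/CrealP; rewrite rpredN ger0_real// divr_ge0// ltW.
have := Dpos (x + t *: D x).
rewrite linearD linearZ /= !(hdotDl, hdotDr) !(hdotZl, hdotZr) Dxx tc -/c -/s.
rewrite (_ : hdot (D (D x)) x = s) 1?Dsym// => h.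
apply/hdot_eq0; rewrite -/s; apply/eqP; rewrite -sqrf_eq0 eq_le exprn_ge0// andbT.
have : 0 <= - (s ^+ 2 * (c + 2)) / (c + 1) ^+ 2.
  suff -> : - (s ^+ 2 * (c + 2)) / (c + 1) ^+ 2 = 0 + t * s + (t * s + t * (t * c)) by [].
  by rewrite /t; field; rewrite gt_eqF.
rewrite pmulr_lge0 ?invr_gt0 ?exprn_gt0// oppr_ge0 pmulr_lle0//.
by rewrite ltr_wpDl.
Qed.

(** Commuting roots satisfy [(D + D') (D - D') = 0]. With [y = D x - D' x], both [<D y, y>] and
    [<D' y, y>] then vanish, so [D y = D' y = 0] and [|y|^2 = <x, D y - D' y> = 0]. *)
Lemma positive_sqrt_unique D D' : positive_op D -> positive_op D' ->
  (forall x, D (D x) = D' (D' x)) -> (forall x, D (D' x) = D' (D x)) -> D =1 D'.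
Proof.
move=> Dpos D'pos DD comm x; apply/subr0_eq; set y := D x - D' x.
have Dy_D'y : D y + D' y = 0.
  by rewrite /y !linearB /= DD comm addrA subrK subrr.
have := congr1 (fun z => hdot z y) Dy_D'y.
rewrite /= hdotDl hdot0l => /eqP; rewrite paddr_eq0// => /andP[/eqP Dyy /eqP D'yy].
have Dy := positive_op_eq0 Dpos Dyy; have D'y := positive_op_eq0 D'pos D'yy.
apply: hdot_eq0; rewrite {1}/y hdotBl.
by rewrite (positive_op_sym Dpos) (positive_op_sym D'pos) Dy D'y !hdot0r subr0.
Qed.

End positive_operators.

Section contraction_sqrt.
Context {R : realType}.
Implicit Types H K : hilbertType R.

(* If Y solves Y = (T + Y^2) / 2, then (I - Y)^2 = I - T.  The increments of the
   iterates are dominated by those of the scalar recursion for T = 1, which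
   increases and stays below 1. *)
Definition sqrt_iter H (T : H -> H) (n : nat) : H -> H :=
  iter n (fun Y x => 2^-1 *: (T x + Y (Y x))) (fun=> 0).

Definition sqrt_majorant (n : nat) : R[i] := iter n (fun t => 2^-1 * (1 + t * t)) 0.

Lemma sqrt_majorant_ge0 n : 0 <= sqrt_majorant n.
Proof. elim: n => //= n IH. by rewrite mulr_ge0 ?invr_ge0 ?addr_ge0 ?mulr_ge0. Qed.

Lemma sqrt_majorant_le1 n : sqrt_majorant n <= 1.
Proof.
elim: n => [|n IH] /=; first exact: ler01.
rewrite mulrC ler_pdivrMr// mul1r [leRHS](_ : _ = 1 + 1)// lerD2l.
by rewrite mulr_ile1// sqrt_majorant_ge0.
Qed.

Lemma sqrt_majorant_le n : sqrt_majorant n <= sqrt_majorant n.+1.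
Proof.
rewrite -subr_ge0 /=; set t := sqrt_majorant n.
have -> : 2^-1 * (1 + t * t) - t = 2^-1 * (1 - t) ^+ 2 by field.
by rewrite mulr_ge0 ?invr_ge0 ?exprn_ge0 ?subr_ge0 ?sqrt_majorant_le1.
Qed.

Lemma sqrt_iter_intertwine H K (T : H -> H) (T' : K -> K) (B : boundedOp H K) :
  (forall x, B (T x) = T' (B x)) ->
  forall n x, B (sqrt_iter T n x) = sqrt_iter T' n (B x).
Proof.
move=> BT; elim=> [|n IH] x /=; first exact: linear0.
by rewrite linearZ linearD /= BT !IH.
Qed.

Context {H : hilbertType R} (T : H -> H).
Hypothesis Tlin : linear T.
Hypothesis Tsym : forall x y, hdot (T x) y = hdot x (T y).
Hypothesis Tle : forall x, `|T x| <= `|x|.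
Let Y := sqrt_iter T.
Let t := sqrt_majorant.

Let Ylin n : linear (Y n).
Proof.
elim: n => [|n IH] a u v /=; first by rewrite scaler0 addr0.
rewrite /= -/(Y n) Tlin !IH scalerA mulrC -scalerA -scalerDr; congr (_ *: _).
by rewrite scalerDr addrACA.
Qed.

Let YB n u v : Y n (u - v) = Y n u - Y n v.
Proof. by rewrite addrC -scaleN1r Ylin scaleN1r addrC. Qed.

Let Ysym n x y : hdot (Y n x) y = hdot x (Y n y).
Proof.
elim: n x y => [|n IH] x y /=; first by rewrite hdot0l hdot0r.
rewrite /= -/(Y n) hdotZl hdotZr hdotDl hdotDr !IH Tsym.
by rewrite fmorphV /= rmorph_nat.
Qed.

Let Yle n x : `|Y n x| <= t n * `|x|.
Proof.
elim: n x => [|n IH] x /=; first by rewrite normr0 mul0r.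
rewrite /= -/(Y n) -/(t n) normrZ ger0_norm ?invr_ge0// -mulrA ler_pM2l ?invr_gt0//.
apply: le_trans (ler_normD _ _) _; rewrite mulrDl mul1r lerD// -mulrA.
by apply: le_trans (IH _) _; rewrite ler_wpM2l// sqrt_majorant_ge0.
Qed.

Let Yle1 n x : `|Y n x| <= `|x|.
Proof.
apply: le_trans (Yle n x) _; rewrite -[leRHS]mul1r ler_wpM2r//.
exact: sqrt_majorant_le1.
Qed.

Let YS n x : Y n.+1 x = 2^-1 *: (T x + Y n (Y n x)).
Proof. by []. Qed.

Let tS n : t n.+1 = 2^-1 * (1 + t n * t n).
Proof. by []. Qed.

Let YSB_le n x : `|Y n.+1 x - Y n x| <= (t n.+1 - t n) * `|x|.
Proof.
elim: n x => [|n IH] x; first by rewrite [Y 0 x]/= [t 0]/= !subr0 Yle.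
rewrite [Y n.+2 x]YS [Y n.+1 x in X in `|_ - X|]YS -scalerBr opprD addrACA subrr add0r.
(* Operator and scalar increments are split alike, as [(Y' - Y) Y' + Y (Y' - Y)], so that the bounds
   match term by term. *)
have -> : Y n.+1 (Y n.+1 x) - Y n (Y n x) =
    (Y n.+1 (Y n.+1 x) - Y n (Y n.+1 x)) + Y n (Y n.+1 x - Y n x).
  by rewrite YB addrA subrK.
have -> : t n.+2 - t n.+1 = 2^-1 * ((t n.+1 - t n) * t n.+1 + t n * (t n.+1 - t n)).
  by rewrite (tS n.+1) {3}(tS n); ring.
rewrite normrZ ger0_norm ?invr_ge0// -[leRHS]mulrA ler_pM2l ?invr_gt0// mulrDl.
apply: le_trans (ler_normD _ _) _; apply: lerD.
  apply: le_trans (IH _) _; rewrite -mulrA ler_wpM2l ?subr_ge0 ?sqrt_majorant_le//.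
apply: le_trans (Yle _ _) _; rewrite -mulrA ler_wpM2l// sqrt_majorant_ge0//.
Qed.

Let Ycvg x : cvgn (Y ^~ x).
Proof.
have seriesY : (Y ^~ x) = series (fun n => Y n.+1 x - Y n x).
  by apply/funext => n; rewrite /series /= telescope_sumr// [Y 0 x]/= subr0.
rewrite seriesY; apply: (@series_comparisonC _ _ _ (fun n => (t n.+1 - t n) * `|x|)).
  by move=> n; exact: YSB_le.
apply: (@nneseries_is_cvgC _ _ `|x|) => n.
  by rewrite mulr_ge0// subr_ge0 sqrt_majorant_le.
rewrite /series /= -mulr_suml telescope_sumr// [t 0]/= subr0.
by rewrite -[leRHS]mul1r ler_wpM2r// sqrt_majorant_le1.
Qed.

Let L x := limn (Y ^~ x).

Let Llin : linear L.
Proof.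
move=> a u v; apply/cvg_lim; first exact: norm_hausdorff.
have -> : Y ^~ (a *: u + v) = (fun n => a *: Y n u + Y n v).
  by apply/funext => n; exact: Ylin.
by apply: cvgD; [apply: cvgZl_tmp|]; exact: Ycvg.
Qed.

Let Lle x : `|L x| <= 1 * `|x|.
Proof.
rewrite mul1r -subr_ge0; apply: (@cvg_ge0C _ _ \oo _ (fun n => `|x| - `|Y n x|)).
  by apply: nearW => n; rewrite subr_ge0 Yle1.
by apply: cvgB; [exact: cvg_cst|apply: cvg_norm; exact: Ycvg].
Qed.

Let LE x : L x = 2^-1 *: (T x + L (L x)).
Proof.
apply/cvg_lim; first exact: norm_hausdorff.
rewrite -cvg_shiftS /=.
apply: cvgZl_tmp; apply: cvgD; first exact: cvg_cst.
(* Operator and argument both move; each [Y n] is a contraction, so the first summand tends to 0. *)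
have -> : (fun n => Y n (Y n x)) = (fun n => Y n (Y n x - L x) + Y n (L x)).
  by apply/funext => n; rewrite YB subrK.
rewrite -[X in _ --> X]add0r; apply: cvgD; last exact: Ycvg.
apply/cvgr0Pnorm_lt => e e0.
have /cvgrPdist_lt/(_ _ e0) : Y n x @[n --> \oo] --> L x by exact: Ycvg.
by apply: filterS => n; apply: le_lt_trans; rewrite [leRHS]distrC.
Qed.

Let Lsym x y : hdot (L x) y = hdot x (L y).
Proof.
rewrite [RHS]hdotC.
have Lx : hdot (Y n x) y @[n --> \oo] --> hdot (L x) y by apply: cvg_hdotl; exact: Ycvg.
have Ly : hdot (Y n x) y @[n --> \oo] --> (hdot (L y) x)^*.
  have -> : (fun n => hdot (Y n x) y) = (fun n => (hdot (Y n y) x)^*).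
    by apply/funext => n; rewrite Ysym [LHS]hdotC.
  by apply: cvg_conjC; apply: cvg_hdotl; exact: Ycvg.
by rewrite -(cvg_lim _ Lx) ?(cvg_lim _ Ly)//; exact: norm_hausdorff.
Qed.

Lemma is_cvg_sqrt_iter x : cvgn (sqrt_iter T ^~ x).
Proof. exact: Ycvg. Qed.

(** The square root of [I - T]. Being an explicit limit, unlike the operator that [op_sqrt] picks,
    it inherits intertwining relations from [T]. *)
Definition contraction_sqrt x := x - limn (sqrt_iter T ^~ x).

(** The limit [L] of the iterates is a symmetric contraction, so [<L x, x> <= |x|^2], and
    [T + L^2 = 2 L] turns [(I - L)^2] into [I - T]. *)
Lemma contraction_sqrt_exists : exists D : boundedOp H H,
  [/\ positive_op D, (forall x, D (D x) = x - T x) & D =1 contraction_sqrt].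
Proof.
have Dlin : linear contraction_sqrt.
  move=> a u v; rewrite /contraction_sqrt -/(L _) -/(L u) -/(L v) Llin.
  by rewrite opprD addrACA -scalerBr.
have Dle x : `|contraction_sqrt x| <= 2 * `|x|.
  apply: le_trans (ler_normB _ _) _; rewrite mulr_natl mulr2n lerD2l.
  by rewrite -[leRHS]mul1r; exact: Lle.
have [D DE] := boundedOp_of Dlin (ler0n _ 2) Dle.
exists D; split=> // x.
  rewrite DE /contraction_sqrt -/(L x) hdotBl subr_ge0 hdot_norm.
  have : hdot (L x) x \is Num.real by apply/CrealP; rewrite -hdotC Lsym.
  move=> /real_ler_norm /le_trans; apply.
  apply: le_trans (hdot_CauchySchwarz _ _) _; rewrite expr2 ler_wpM2r//.
  by rewrite -[leRHS]mul1r; exact: Lle.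
rewrite !DE /contraction_sqrt -/(L x) -/(L _).
have -> : L (x - L x) = L x - L (L x).
  by rewrite addrC -scaleN1r Llin scaleN1r addrC.
have -> : L (L x) = 2 *: L x - T x.
  by rewrite [in RHS]LE scalerA divff ?pnatr_eq0// scale1r addrAC subrr add0r.
by rewrite scaler_nat mulr2n opprB [_ - T x - _]addrAC addrK addrA subrK.
Qed.

End contraction_sqrt.

Section contraction_sqrt_theory.
Context {R : realType}.
Implicit Types H K : hilbertType R.

(** Each iterate is a polynomial in [T], so [B] intertwines the iterates and, by continuity, their
    limits. *)
Lemma contraction_sqrt_intertwine H K (T : H -> H) (T' : K -> K) (B : boundedOp H K) :
  linear T -> (forall x, `|T x| <= `|x|) -> (forall x, B (T x) = T' (B x)) ->
  forall x, B (contraction_sqrt T x) = contraction_sqrt T' (B x).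
Proof.
move=> Tlin Tle BT x; rewrite linearB /=; congr (_ - _).
apply/esym/cvg_lim; first exact: norm_hausdorff.
have -> : sqrt_iter T' ^~ (B x) = B \o (sqrt_iter T ^~ x).
  by apply/funext => n /=; rewrite (sqrt_iter_intertwine BT).
by apply: continuous_cvg; [exact: cts_fun|exact: is_cvg_sqrt_iter].
Qed.

(** The chosen root [D] satisfies [T = I - D^2], so it commutes with [T] and hence with
    [contraction_sqrt T]; uniqueness among commuting roots identifies the two. *)
Lemma op_sqrtP H (T : H -> H) : linear T ->
  (forall x y, hdot (T x) y = hdot x (T y)) -> (forall x, `|T x| <= `|x|) ->
  let D := op_sqrt (fun x => x - T x) in
  [/\ positive_op D, (forall x, D (D x) = x - T x) & D =1 contraction_sqrt T].
Proof.
move=> Tlin Tsym Tle D.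
have [D0 [D0pos D0sq D0E]] := contraction_sqrt_exists Tlin Tsym Tle.
have [Dpos Dsq] : positive_op D /\ forall x, D (D x) = x - T x.
  apply: (@getI _ [set D : boundedOp H H |
    positive_op D /\ forall x, D (D x) = x - T x] D0); by split.
split=> // x; rewrite -D0E; apply: positive_sqrt_unique => // {}x.
  by rewrite Dsq D0sq.
rewrite !D0E; apply: contraction_sqrt_intertwine => // {}x.
have TE y : T y = y - D (D y) by rewrite Dsq opprB addrC subrK.
by rewrite !TE linearB.
Qed.

End contraction_sqrt_theory.

Section defect_theory.
Context {R : realType}.
Implicit Types H K : hilbertType R.

Lemma adjoint_contraction H K (T : boundedOp H K) :
  (forall x, `|T x| <= `|x|) -> forall y, `|adjoint T y| <= `|y|.
Proof.
move=> Tle y; have [->|Ay0] := eqVneq (adjoint T y) 0; first by rewrite normr0.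
rewrite -(ler_pM2r (_ : 0 < `|adjoint T y|)) ?normr_gt0// -expr2.
rewrite -[leLHS]ger0_norm ?exprn_ge0// -hdot_norm -adjointP mulrC.
by apply: le_trans (hdot_CauchySchwarz _ _) _; rewrite ler_wpM2r.
Qed.

(** The hypothesis makes [u] orthogonal to the range of [T], so [|u|^2 = <u - T x, u>] for all [x],
    although some [T x] would be closer to [u] than [|u|] if [u] were nonzero. *)
Lemma closed_range_inj H K (T : boundedOp H K) (u : subHilbert (closed_range T)) :
  adjoint T (\val u) = 0 -> u = 0.
Proof.
move=> Tu; apply: val_inj; apply: hdot_eq0; apply/eqP; apply/negPn/negP => uu0.
have u0 : 0 < `|\val u| by rewrite normr_gt0; apply: contra_neq uu0 => ->; rewrite hdot0l.
have [_ [x _ <-]] : exists2 y, range T y & `|\val u - y| < `|\val u|.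
  apply: (iffLR (closure_normP _ _)) => //; exact: (set_mem (subspace_valP u)).
move=> /lt_geF/negP; apply; rewrite -(ler_pM2r u0) -expr2 -hdot_norm.
have -> : hdot (\val u) (\val u) = hdot (\val u - T x) (\val u).
  by rewrite hdotBl adjointP Tu hdot0r subr0.
rewrite -[leLHS]ger0_norm; first exact: hdot_CauchySchwarz.
by rewrite hdotBl adjointP Tu hdot0r subr0 hdot_ge0.
Qed.

Context {H : hilbertType R} (P : boundedOp H H).
Hypothesis Ple : forall x, `|P x| <= `|x|.

Let T x := adjoint P (P x).

Let Tlin : linear T.
Proof. by move=> a u v; rewrite /T !linearP. Qed.

Let Tle x : `|T x| <= `|x|.
Proof. exact: le_trans (adjoint_contraction Ple _) (Ple _). Qed.

Let defectP : [/\ positive_op (defect P),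
  (forall x, defect P (defect P x) = x - adjoint P (P x)) &
  defect P =1 contraction_sqrt T].
Proof.
apply: op_sqrtP => // x y; by rewrite /T -adjointPr -adjointP.
Qed.

Lemma defect_sqr x : defect P (defect P x) = x - adjoint P (P x).
Proof. by have [_ ->] := defectP. Qed.

Lemma defect_sym x y : hdot (defect P x) y = hdot x (defect P y).
Proof. by have [Dpos _ _] := defectP; exact: positive_op_sym. Qed.

Lemma adjoint_defect x : adjoint (defect P) x = defect P x.
Proof. by apply: hdot_injr => w; rewrite -adjointP defect_sym. Qed.

Lemma sqr_norm_defect x : `|defect P x| ^+ 2 = `|x| ^+ 2 - `|P x| ^+ 2.
Proof.
by rewrite -!hdot_norm defect_sym defect_sqr hdotBr -adjointP.
Qed.

Lemma defect_inj (u : defectType P) : defect P (\val u) = 0 -> u = 0.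
Proof. by rewrite -adjoint_defect; exact: closed_range_inj. Qed.

Lemma defectE : defect P =1 contraction_sqrt (fun x => adjoint P (P x)).
Proof. by have [] := defectP. Qed.

End defect_theory.

Section defect_adjoint.
Context {R : realType} {H : hilbertType R} (P : boundedOp H H).
Hypothesis Ple : forall x, `|P x| <= `|x|.
Let Qle := adjoint_contraction Ple.

Lemma defect_adjoint_sqr x :
  defect (adjoint P) (defect (adjoint P) x) = x - P (adjoint P x).
Proof. by rewrite defect_sqr// adjointK. Qed.

(** [P] intertwines [P^* P] with [P P^*], hence also the square roots of [I - P^* P] and
    [I - P P^*]. *)
Lemma defect_intertwine x : P (defect P x) = defect (adjoint P) (P x).
Proof.
rewrite !defectE//; apply: contraction_sqrt_intertwine => [a u v|y|y].
- by rewrite !linearP.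
- exact: le_trans (Qle _) (Ple _).
- by rewrite adjointK.
Qed.

Lemma defect_adjoint_intertwine x :
  adjoint P (defect (adjoint P) x) = defect P (adjoint P x).
Proof.
apply: hdot_injr => w.
by rewrite -adjointP -defect_sym// -defect_intertwine adjointP defect_sym.
Qed.

End defect_adjoint.

(** * Contractivity of [P] *)

Section gamma_contraction_theory.
Context {R : realType} {H : hilbertType R}.

(** Boundedness of [T] makes the [sup] in [op_norm] a true supremum, which is tested at
    [x / |x|]. *)
Lemma op_norm_bound (K : hilbertType R) (T : boundedOp H K) x :
  `|T x| <= ((op_norm T)%:C)%C * `|x|.
Proof.
have [->|x0] := eqVneq x 0; first by rewrite linear0 !normr0 mulr0.
have [M M0 TM] := boundedOp_le T.
have n0 : 0 < `|x| by rewrite normr_gt0.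
rewrite -ler_pdivrMr// mulrC.
have -> : `|x|^-1 * `|T x| = `|T (`|x|^-1 *: x)|.
  by rewrite linearZ normrZ ger0_norm// invr_ge0.
rewrite [leLHS]ge0_ReE// lecR; apply: ub_le_sup.
  exists (complex.Re M) => _ [y y1 <-].
  have : `|T y| <= M by apply: le_trans (TM y) _; rewrite -[leRHS]mulr1 ler_wpM2l.
  by rewrite lecE => /andP[].
by exists (`|x|^-1 *: x) => //=; rewrite normrZ ger0_norm ?invr_ge0// mulVf// gt_eqF.
Qed.

(** The von Neumann inequality is applied to the second coordinate, the polynomial ['X%:P], which is
    [z1 * z2] on [Gamma_set]. *)
Lemma Gamma_contraction_norm_le (S P : boundedOp H H) :
  Gamma_contraction S P -> forall x, `|P x| <= `|x|.
Proof.
move=> [_ /(_ ('X%:P))] SP x.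
have PE : horner2_op 'X%:P S P = P.
  apply/funext => y; rewrite /horner2_op size_polyC polyX_eq0 big_ord1 /=.
  rewrite coefC eqxx size_polyX !big_ord_recl big_ord0 /= !coefX /=.
  by rewrite scale0r add0r scale1r addr0.
have P1 : op_norm P <= 1.
  rewrite PE in SP; apply: le_trans SP _; apply: ge_sup.
    exists (complex.Re `|horner2 'X%:P (0 + 0, 0 * 0)|), (0 + 0, 0 * 0) => //.
    by exists 0, 0; split; rewrite ?normr0// ler01.
  move=> _ [w [z1 [z2 [z1le z2le ->]]] <-]; rewrite /horner2 hornerC hornerX.
  have : `|z1 * z2| <= 1 by rewrite normrM mulr_ile1.
  by rewrite lecE => /andP[].
apply: le_trans (op_norm_bound _ _) _; rewrite -[leRHS]mul1r ler_wpM2r//.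
by rewrite -[1]/((1%:C)%C) lecR.
Qed.

End gamma_contraction_theory.

(** * The Hardy space *)

Section hardy_theory.
Context {R : realType}.
Implicit Types E : hilbertType R.

Lemma hardy_normE E (f : hardy E) :
  series (fun n => `|f n| ^+ 2 : R[i]) @ \oo --> `|f| ^+ 2.
Proof.
rewrite -hdot_norm.
have <- : series (fun n => hdot (f n) (f n)) = series (fun n => `|f n| ^+ 2 : R[i]).
  by congr series; apply/funext => n; exact: hdot_norm.
exact: is_cvg_hardy_dot.
Qed.

Lemma hardy_series_le E (f : hardy E) N : series (fun n => `|f n| ^+ 2 : R[i]) N <= `|f| ^+ 2.
Proof.
rewrite -(cvg_lim _ (hardy_normE (f := f))); last exact: norm_hausdorff.
apply: (@series_le_limC _ (fun n => `|f n| ^+ 2 : R[i])); last exact: is_cvg_hardy_sq.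
by move=> n; rewrite exprn_ge0.
Qed.

Lemma hardy_of_bounded E (a : nat -> E) (M : R[i]) :
  (forall N, series (fun n => `|a n| ^+ 2 : R[i]) N <= M) ->
  exists f : hardy E, forall n, f n = a n.
Proof.
move=> aM; have aP : a \in hardy_pred.
  by apply: mem_set; apply: (nneseries_is_cvgC _ aM) => n; rewrite exprn_ge0.
by exists (Hardy_of aP).
Qed.

Fact hardy_backshift_subproof E (f : hardy E) : (fun n => f n.+1) \in hardy_pred.
Proof.
apply: mem_set; apply: (@nneseries_is_cvgC _ _ (`|f| ^+ 2)) => N.
  by rewrite exprn_ge0.
apply: le_trans (hardy_series_le f N.+1).
by rewrite /series /= [leRHS]big_nat_recl//= lerDr exprn_ge0.
Qed.

(** The adjoint of [hardy_shift], by [hdot_hardy_shift] below. *)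
Definition hardy_backshift E (f : hardy E) : hardy E :=
  Hardy_of (hardy_backshift_subproof f).

Lemma iter_backshiftE E (g : hardy E) n k : iter n (@hardy_backshift E) g k = g (k + n)%N.
Proof. by elim: n k => [|n IH] k /=; rewrite ?addn0// IH addSnnS. Qed.

Lemma hdot_hardyS E (f g : hardy E) :
  hdot f g = hdot (f 0%N) (g 0%N) + hdot (hardy_backshift f) (hardy_backshift g).
Proof.
apply/cvg_lim; first exact: norm_hausdorff.
rewrite -cvg_shiftS /=.
have -> : (fun n => series (fun n => hdot (f n) (g n)) n.+1) =
    (fun n => hdot (f 0%N) (g 0%N) + series (fun n => hdot (f n.+1) (g n.+1)) n).
  by apply/funext => n; rewrite /series /= big_nat_recl.
apply: cvgD; first exact: cvg_cst.
exact: (@is_cvg_hardy_dot R E (hardy_backshift f) (hardy_backshift g)).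
Qed.

Lemma norm_hardy_backshift E (f : hardy E) : `|hardy_backshift f| <= `|f|.
Proof.
rewrite -ler_sqr ?nnegrE// -!hdot_norm [leRHS]hdot_hardyS lerDr.
exact: hdot_ge0.
Qed.

Lemma hdot_hardy_shift E (f g : hardy E) :
  hdot (hardy_shift f) g = hdot f (hardy_backshift g).
Proof.
rewrite hdot_hardyS [hardy_shift f 0%N]/= hdot0l add0r; congr (hdot _ _).
Qed.

Lemma hdot_id_tensor E E' (A : boundedOp E E') (f : hardy E) (g : hardy E') :
  hdot (id_tensor A f) g = hdot f (id_tensor (adjoint A) g).
Proof.
by congr (limn (series _)); apply/funext => n; exact: adjointP.
Qed.

Lemma geometric_le2 (z : R[i]) N : 0 <= z -> z <= 2^-1 -> \sum_(0 <= i < N) z ^+ i <= 2.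
Proof.
move=> z0 z2.
elim: N => [|N IH]; first by rewrite big_geq.
rewrite big_nat_recl// expr0.
have -> : \sum_(0 <= i < N) z ^+ i.+1 = z * \sum_(0 <= i < N) z ^+ i.
  by rewrite mulr_sumr; apply: eq_bigr => i _; rewrite exprS.
rewrite [leRHS](_ : _ = 1 + 2^-1 * 2); last by rewrite mulVf ?pnatr_eq0.
by rewrite lerD2l ler_pM// sumr_ge0// => i _; rewrite exprn_ge0.
Qed.

Lemma is_cvg_power_series (V : completeNormedModType R[i]) (a : nat -> V) (M z : R[i]) :
  (forall n, `|a n| <= M) -> `|z| < 1 -> cvgn (series (fun n => z ^+ n *: a n)).
Proof.
move=> aM z1; apply: (@series_comparisonC _ _ _ (fun n => M * `|z| ^+ n)).
  by move=> n; rewrite normrZ normrX mulrC ler_wpM2r// exprn_ge0.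
apply: is_cvg_seriesMC; apply: (@nneseries_is_cvgC _ _ (1 - `|z|)^-1) => n.
  by rewrite exprn_ge0.
rewrite -[leRHS]mul1r ler_pdivlMr ?subr_gt0// mulrC /series /= big_mkord.
by rewrite -opprB mulNr -subrX1 opprB gerBl exprn_ge0.
Qed.

(** If [h = f - g] had a first nonzero coefficient [h m], then at small [z] the term [z ^+ m *: h m]
    would outweigh the tail, while the series sums to 0. This lets the pointwise relation
    [char_mult] determine coefficients. *)
Lemma hardy_eval_inj E (f g : hardy E) :
  (forall z, `|z| < 1 -> hardy_eval f z = hardy_eval g z) -> f = g.
Proof.
move=> fg; apply/subr0_eq; set h := f - g.
have eval0 z : `|z| < 1 -> series (fun n => z ^+ n *: h n) @ \oo --> (0 : E).
  move=> z1; rewrite -(subrr (hardy_eval f z)) {2}fg//.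
  have -> : series (fun n => z ^+ n *: h n) =
      series (fun n => z ^+ n *: f n) - series (fun n => z ^+ n *: g n).
    rewrite -seriesN -seriesD; congr series; apply/funext => n.
    by rewrite -[RHS]/(z ^+ n *: f n - z ^+ n *: g n) -scalerBr.
  by apply: cvgB; exact: is_cvg_hardy_eval.
clearbody h; apply/val_inj/funext => m /=; elim/ltn_ind: m => m IH.
apply/eqP/negPn/negP => hm0.
have hm : 0 < `|h m| by rewrite normr_gt0.
have h0 : 0 < `|h| by apply: lt_le_trans hm (hardy_coef_le _ _).
(* Since [|h k| <= |h|] and [z <= 2^-1], the tail divided by [z ^+ m] is at most [2 * z * |h|],
   which is half of [|h m|]. *)
pose z := `|h m| / (4 * `|h|).
have z0 : 0 < z by rewrite divr_gt0// mulr_gt0.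
have z2 : z <= 4^-1.
  rewrite /z invfM mulrCA -[leRHS]mulr1 ler_pM2l ?invr_gt0// ler_pdivrMr// mul1r.
  exact: hardy_coef_le.
have z2' : z <= 2^-1.
  by apply: le_trans z2 _; rewrite lef_pV2 ?posrE// ler_nat.
have z1 : `|z| < 1.
  by rewrite gtr0_norm//; apply: le_lt_trans z2' _; rewrite invf_lt1// ltr1n.
have bound N : `|h m| / 2 <= z ^- m * `|series (fun n => z ^+ n *: h n) (N.+1 + m)%N|.
  rewrite /series /= (big_cat_nat _ (n := m))//= ?leq_addl//.
  rewrite big_nat big1 ?add0r; last by move=> i /andP[_ im]; rewrite IH// scaler0.
  rewrite -[X in \sum_(X <= _ < _) _]add0n big_addn addnK big_nat_recl//= add0n.
  have -> : z ^+ m *: h m + \sum_(0 <= i < N) z ^+ (i.+1 + m) *: h (i.+1 + m)%N =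
      z ^+ m *: (h m + z *: \sum_(0 <= i < N) z ^+ i *: h (i.+1 + m)%N).
    rewrite scalerDr; congr (_ + _); rewrite !scaler_sumr; apply: eq_bigr => i _.
    by rewrite !scalerA addSn exprS -addnC exprD mulrCA mulrA.
  rewrite normrZ ger0_norm ?exprn_ge0 ?(ltW z0)// mulrA mulVf ?expf_neq0 ?gt_eqF// mul1r.
  set s := \sum_(_ <= _ < _) _.
  have sle : `|z *: s| <= `|h m| / 2.
    have -> : `|h m| / 2 = z * (2 * `|h|).
      by rewrite /z; field; rewrite gt_eqF.
    rewrite normrZ gtr0_norm// ler_pM2l//.
    apply: le_trans (ler_norm_sum _ _ _) _.
    apply: (@le_trans _ _ (\sum_(0 <= i < N) z ^+ i * `|h|)).
      apply: ler_sum => i _; rewrite normrZ ger0_norm ?exprn_ge0 ?(ltW z0)//.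
      by rewrite ler_wpM2l ?exprn_ge0 ?(ltW z0)// hardy_coef_le.
    by rewrite -mulr_suml ler_wpM2r// geometric_le2// ltW.
  apply: (@le_trans _ _ (`|h m| - `|z *: s|)).
    by rewrite lerBrDr -lerBrDl {1}[`|h m|]splitr addrK.
  by rewrite -[z *: s]opprK normrN; exact: lerB_dist.
have : `|h m| / 2 <= 0.
  rewrite -subr_ge0 sub0r.
  apply: (@cvg_ge0C _ _ \oo _ (fun N => z ^- m *
      `|series (fun n => z ^+ n *: h n) (N.+1 + m)%N| - `|h m| / 2)).
    by apply: nearW => N; rewrite subr_ge0.
  rewrite -[X in _ --> X]sub0r; apply: cvgB; last exact: cvg_cst.
  rewrite -(mulr0 (z ^- m)) -(normr0 E).
  apply: cvgMl_tmp; apply: cvg_norm.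
  have := eval0 _ z1; rewrite -(cvg_shiftn m.+1) /=.
  by under eq_fun do rewrite -addSnnS.
by rewrite pmulr_lle0 ?invr_gt0// normr_le0 (negbTE hm0).
Qed.

End hardy_theory.

(** * The characteristic function as a transfer function *)

Section resolvent.
Context {R : realType} {H : hilbertType R}.

(** The Neumann series of [A] is a bounded two-sided inverse of [I - A], so the set from which
    [op_inv] picks is nonempty. *)
Lemma op_invK (A : boundedOp H H) (r : R[i]) (x : H) : 0 <= r < 1 ->
  (forall x, `|A x| <= r * `|x|) -> op_inv (fun y => y - A y) (x - A x) = x.
Proof.
move=> /andP[r0 r1] Ale.
have iterA n y : `|iter n A y| <= r ^+ n * `|y|.
  elim: n => [|n IH]; first by rewrite expr0 mul1r.
  rewrite iterS exprS -mulrA; apply: le_trans (Ale _) _.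
  by rewrite ler_wpM2l.
have rV0 : 0 <= (1 - r)^-1 by rewrite invr_ge0 subr_ge0 ltW.
have sumr n : series (fun k => r ^+ k) n <= (1 - r)^-1.
  rewrite -[leRHS]mul1r ler_pdivlMr ?subr_gt0// mulrC /series /= big_mkord.
  by rewrite -opprB mulNr -subrX1 opprB gerBl exprn_ge0.
have cvg_iter y : cvgn (series (fun n => iter n A y)).
  apply: (@series_comparisonC _ _ _ (fun n => `|y| * r ^+ n)).
    by move=> n; rewrite mulrC.
  apply: is_cvg_seriesMC; apply: (@nneseries_is_cvgC _ _ (1 - r)^-1) => // n.
  by rewrite exprn_ge0.
pose B y := limn (series (fun n => iter n A y)).
have iterlin n : linear (iter n A).
  by elim: n => // n IH a u v; rewrite !iterS IH linearP.
have Blin : linear B.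
  move=> a u v; apply/cvg_lim; first exact: norm_hausdorff.
  have -> : series (fun n => iter n A (a *: u + v)) =
      (fun n => a *: series (fun n => iter n A u) n + series (fun n => iter n A v) n).
    apply/funext => n; rewrite /series /= scaler_sumr -big_split /=.
    by apply: eq_bigr => i _; exact: iterlin.
  by apply: cvgD; [apply: cvgZl_tmp|]; exact: cvg_iter.
have Ble y : `|B y| <= (1 - r)^-1 * `|y|.
  rewrite -subr_ge0; apply: (@cvg_ge0C _ _ \oo _
    (fun n => (1 - r)^-1 * `|y| - `|series (fun n => iter n A y) n|)).
    apply: nearW => n; rewrite subr_ge0; apply: le_trans (ler_norm_sum _ _ _) _.
    apply: (@le_trans _ _ (\sum_(0 <= k < n) r ^+ k * `|y|)).
      by apply: ler_sum => k _; exact: iterA.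
    by rewrite -mulr_suml ler_wpM2r//; exact: sumr.
  by apply: cvgB; [exact: cvg_cst|apply: cvg_norm; exact: cvg_iter].
have BE y : B y = y + B (A y).
  apply/cvg_lim; first exact: norm_hausdorff.
  rewrite -cvg_shiftS /=.
  have -> : (fun n => series (fun n => iter n A y) n.+1) =
      (fun n => y + series (fun n => iter n A (A y)) n).
    apply/funext => n; rewrite /series /= big_nat_recl//=; congr (_ + _).
    by apply: eq_bigr => i _; rewrite -iterSr.
  by apply: cvgD; [exact: cvg_cst|exact: cvg_iter].
have AB y : A (B y) = B (A y).
  apply/esym/cvg_lim; first exact: norm_hausdorff.
  have -> : series (fun n => iter n A (A y)) = A \o series (fun n => iter n A y).
    apply/funext => n; rewrite /series /= linear_sum; apply: eq_bigr => i _.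
    by rewrite -iterSr.
  by apply: continuous_cvg; [exact: cts_fun|exact: cvg_iter].
have [C CB] := boundedOp_of Blin rV0 Ble.
have BB u v : B (u - v) = B u - B v.
  by rewrite addrC -scaleN1r Blin scaleN1r addrC.
have [|TK _] := @getI _ [set B0 : boundedOp H H |
  cancel (fun y => y - A y) B0 /\ cancel B0 (fun y => y - A y)] C.
  by split=> y /=; rewrite !CB ?AB ?BB {1}BE addrK.
exact: TK.
Qed.

End resolvent.

Section closed_range_map.
Context {R : realType} {H K H' K' : hilbertType R}.

Lemma closed_range_map (T : boundedOp H K) (T' : boundedOp H' K') (B : boundedOp K K') :
  (forall x, exists x', B (T x) = T' x') ->
  forall u : subHilbert (closed_range T),
  exists v : subHilbert (closed_range T'), \val v = B (\val u).
Proof.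
move=> BT u; have [M M0 BM] := boundedOp_le B.
have Bu : B (\val u) \in subspace_pred (closed_range T').
  apply/mem_set/closure_normP => e e0.
  have M1 : 0 < M + 1 by rewrite ltr_wpDl.
  have [|_ [x _ <-]] := iffLR (closure_normP _ _) (set_mem (subspace_valP u)) (e / (M + 1)).
    by rewrite divr_gt0.
  rewrite ltr_pdivlMr// => ux; have [x' BTx] := BT x.
  exists (T' x'); first by exists x'.
  rewrite -BTx -linearB; apply: le_lt_trans (BM _) _; apply: le_lt_trans ux.
  by rewrite mulrC ler_wpM2l// lerDl.
by exists (Subspace_of Bu).
Qed.

End closed_range_map.

Section hardy_subspace.
Context {R : realType} {H : hilbertType R} (W : closed_subspace H).

Lemma cvg_val_hardy_eval (f : hardy (subHilbert W)) (z : R[i]) : `|z| < 1 ->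
  series (fun n => z ^+ n *: \val (f n)) @ \oo --> \val (hardy_eval f z).
Proof.
move=> z1.
have /cvgrPdist_lt fz : series (fun n => z ^+ n *: f n) @ \oo --> hardy_eval f z.
  exact: is_cvg_hardy_eval.
apply/cvgrPdist_lt => e /fz; apply: filterS => n.
by rewrite subspace_normE raddfB raddf_sum.
Qed.

End hardy_subspace.

Section characteristic_function.
Context {R : realType} {H : hilbertType R} (P : boundedOp H H).
Hypothesis Ple : forall x, `|P x| <= `|x|.
Local Notation Q := (adjoint P).
Local Notation D := (defect P).
Local Notation D' := (defect (adjoint P)).
Let Qle : forall x, `|Q x| <= `|x| := adjoint_contraction Ple.

(* The operators [Q D; D' -P] and its adjoint [P D'; D -Q] are isometric. *)
Lemma colligation_norm x u :
  `|Q x + D u| ^+ 2 + `|D' x - P u| ^+ 2 = `|x| ^+ 2 + `|u| ^+ 2.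
Proof.
have DQ : hdot (Q x) (D u) = hdot (D' x) (P u).
  by rewrite -defect_sym// -defect_adjoint_intertwine// -adjointPr.
have QD : hdot (D u) (Q x) = hdot (P u) (D' x) by rewrite hdotC DQ -hdotC.
rewrite sqr_norm_hdotD sqr_norm_hdotB DQ QD.
rewrite (sqr_norm_defect Ple) (sqr_norm_defect Qle); ring.
Qed.

Lemma colligation_adjoint_norm y v :
  `|P y + D' v| ^+ 2 + `|D y - Q v| ^+ 2 = `|y| ^+ 2 + `|v| ^+ 2.
Proof.
have DP : hdot (P y) (D' v) = hdot (D y) (Q v).
  by rewrite -defect_sym// -defect_intertwine// adjointP.
have PD : hdot (D' v) (P y) = hdot (Q v) (D y) by rewrite hdotC DP -hdotC.
rewrite sqr_norm_hdotD sqr_norm_hdotB DP PD.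
rewrite (sqr_norm_defect Ple) (sqr_norm_defect Qle); ring.
Qed.

(** The generating functions [X], [F], [G] of [x], [f], [g] satisfy [X = z (Q X + D F)] and
    [G = D' X - P F]; eliminating [X] through the resolvent leaves [G = Theta_P(z) F]. The bound on
    [x] makes [X] converge. *)
Lemma colligation_char_mult (f : hardy (defectType P)) (g : hardy (defectType (adjoint P)))
    (x : nat -> H) (M : R[i]) :
  x 0%N = 0 -> (forall n, x n.+1 = Q (x n) + D (\val (f n))) ->
  (forall n, `|x n| <= M) -> (forall n, \val (g n) = D' (x n) - P (\val (f n))) ->
  char_mult P f g.
Proof.
move=> x0 xS xM gE z z1.
have cf := @cvg_val_hardy_eval _ _ _ f z z1; have cg := @cvg_val_hardy_eval _ _ _ g z z1.
set Fz := \val (hardy_eval f z) in cf *; set Gz := \val (hardy_eval g z) in cg *.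
have /cvg_ex[X cx] := @is_cvg_power_series _ _ x M z xM z1.
have applyE (A : boundedOp H H) (a : nat -> H) :
    A \o series (fun n => z ^+ n *: a n) = series (fun n => z ^+ n *: A (a n)).
  apply/funext => n; rewrite /series /= linear_sum.
  by apply: eq_bigr => i _; rewrite linearZ.
have applyC (A : boundedOp H H) (a : nat -> H) (l : H) :
    series (fun n => z ^+ n *: a n) @ \oo --> l ->
    series (fun n => z ^+ n *: A (a n)) @ \oo --> A l.
  by move=> al; rewrite -applyE; apply: continuous_cvg => //; exact: cts_fun.
have XE : X = z *: (Q X + D Fz).
  rewrite -[LHS](cvg_lim _ cx); last exact: norm_hausdorff.
  apply/cvg_lim; first exact: norm_hausdorff.
  rewrite -cvg_shiftS /=.
  have -> : (fun n => series (fun n => z ^+ n *: x n) n.+1) =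
      (fun n => z *: (series (fun n => z ^+ n *: Q (x n)) n +
                      series (fun n => z ^+ n *: D (\val (f n))) n)).
    apply/funext => n; rewrite /series /= big_nat_recl//= x0 scaler0 add0r.
    rewrite -big_split scaler_sumr; apply: eq_bigr => i _ /=.
    by rewrite xS exprS -scalerDr scalerA.
  by apply: cvgZl_tmp; apply: cvgD; [exact: (applyC _ _ _ cx)|exact: (applyC _ _ _ cf)].
have GE : Gz = D' X - P Fz.
  rewrite -[LHS](cvg_lim _ cg); last exact: norm_hausdorff.
  apply/cvg_lim; first exact: norm_hausdorff.
  have -> : series (fun n => z ^+ n *: \val (g n)) =
      series (fun n => z ^+ n *: D' (x n)) - series (fun n => z ^+ n *: P (\val (f n))).
    rewrite -seriesN -seriesD; congr series; apply/funext => n.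
    by rewrite gE scalerBr.
  by apply: cvgB; [exact: (applyC _ _ _ cx)|exact: (applyC _ _ _ cf)].
rewrite GE /char_fun -/Fz addrC; congr (_ + _).
have zQlin : linear (fun y => z *: Q y).
  by move=> a u v; rewrite linearP scalerDr !scalerA mulrC.
have zQle y : `|z *: Q y| <= `|z| * `|y|.
  by rewrite normrZ ler_wpM2l.
have [A AE] := boundedOp_of zQlin (normr_ge0 z) zQle.
have Ale y : `|A y| <= `|z| * `|y| by rewrite AE.
have zr : 0 <= `|z| < 1 by rewrite normr_ge0.
(* [u] plays the part of [X / z] but also makes sense at [z = 0]; from [z u = X] follows
   [u - z Q u = D F]. *)
pose u := Q X + D Fz.
have -> : (fun y => y - z *: adjoint P y) = (fun y => y - A y).
  by apply/funext => y; rewrite AE.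
have -> : defect P Fz = u - A u by rewrite AE -linearZ -XE /u addrC addKr.
by rewrite (op_invK _ zr Ale) {1}XE linearZ.
Qed.

Lemma P_defect_space (u : defectType P) :
  exists v : defectType (adjoint P), \val v = P (\val u).
Proof.
by apply: closed_range_map => x; exists (P x); exact: defect_intertwine.
Qed.

Lemma adjoint_defect_space (v : defectType (adjoint P)) :
  exists u : defectType P, \val u = Q (\val v).
Proof.
by apply: closed_range_map => x; exists (Q x); exact: defect_adjoint_intertwine.
Qed.

(** By the energy balance, the system driven by [f] has bounded states and a square summable output
    [g']. As [M_Theta f] is both [g'] and [g], the two agree by [hardy_eval_inj]. *)
Lemma char_mult_coef (f : hardy (defectType P)) (g : hardy (defectType (adjoint P))) :
  char_mult P f g -> exists x : nat -> H, [/\ x 0%N = 0,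
    forall n, x n.+1 = Q (x n) + D (\val (f n)),
    forall n, `|x n| <= `|f| &
    forall n, \val (g n) = D' (x n) - P (\val (f n))].
Proof.
move=> fg.
pose x := fix x n := if n is m.+1 then Q (x m) + D (\val (f m)) else 0.
have energy N : \sum_(0 <= n < N) `|D' (x n) - P (\val (f n))| ^+ 2 + `|x N| ^+ 2 =
    \sum_(0 <= n < N) `|f n| ^+ 2.
  elim: N => [|N IH]; first by rewrite !big_geq//= normr0 expr0n addr0.
  rewrite !big_nat_recr//= -IH -!addrA; congr (_ + _).
  by rewrite addrC colligation_norm.
have xle n : `|x n| <= `|f|.
  rewrite -ler_sqr ?nnegrE//; apply: le_trans (hardy_series_le f n).
  by rewrite /series /= -energy lerDr sumr_ge0// => i _; rewrite exprn_ge0.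
have /choice[a aE] n : exists v : defectType (adjoint P), \val v = D' (x n) - P (\val (f n)).
  have [v vE] := P_defect_space (f n).
  by exists (to_closed_range D' (x n) - v); rewrite -vE.
have [|g' g'E] := @hardy_of_bounded _ _ a (`|f| ^+ 2).
  move=> N; apply: le_trans (hardy_series_le f N).
  rewrite /series /= -energy; under eq_bigr do rewrite subspace_normE aE.
  by rewrite lerDl exprn_ge0.
have g'V n : \val (g' n) = D' (x n) - P (\val (f n)) by rewrite g'E aE.
have fg' : char_mult P f g' by apply: (@colligation_char_mult f g' x `|f|).
have <- : g' = g.
  by apply: hardy_eval_inj => z z1; apply: val_inj; rewrite /= fg// fg'.
by exists x.
Qed.

Definition poisson_seq (h : H) (n : nat) : defectType (adjoint P) :=
  to_closed_range D' (iter n Q h).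

(** The sum telescopes: [D'^2 = I - P Q] gives [<D' a, D' b> = <a, b> - <Q a, Q b>]. *)
Lemma poisson_series x y N :
  series (fun n => hdot (poisson_seq x n) (poisson_seq y n)) N =
  hdot x y - hdot (iter N Q x) (iter N Q y).
Proof.
elim: N => [|N IH]; first by rewrite /series /= big_geq// subrr.
rewrite /series /= big_nat_recr//= -[X in X + _]/(series _ N) IH.
rewrite -[hdot (poisson_seq x N) _]/(hdot (D' (iter N Q x)) (D' (iter N Q y))).
rewrite defect_sym// defect_adjoint_sqr// hdotBr.
by rewrite (adjointPr P) addrA subrK.
Qed.

End characteristic_function.

(** * The functional model *)

Section model.
Context {R : realType} {H : hilbertType R} (P : boundedOp H H).
Hypothesis Ple : forall x, `|P x| <= `|x|.
Hypothesis Ppure : pure_op P.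
Local Notation Q := (adjoint P).
Local Notation D := (defect P).
Local Notation D' := (defect (adjoint P)).
Let Qle : forall x, `|Q x| <= `|x| := adjoint_contraction Ple.

Let iterQ_le n x : `|iter n Q x| <= `|x|.
Proof. by elim: n => //= n IH; exact: le_trans (Qle _) IH. Qed.

(** Purity enters through this limit, which removes the remainders of the telescoped sums for the
    isometry and for the orthogonality. *)
Let hdot_iterQ_cvg0 (u : nat -> H) (M : R[i]) (h : H) : (forall n, `|u n| <= M) ->
  hdot (u n) (iter n Q h) @[n --> \oo] --> (0 : R[i]).
Proof.
move=> uM; have M0 : 0 <= M := le_trans (normr_ge0 _) (uM 0%N).
have M1 : 0 < M + 1 by rewrite ltr_wpDl.
apply/cvgr0Pnorm_lt => e e0.
have e1 : 0 < e / (M + 1) by rewrite divr_gt0.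
have /cvgr0Pnorm_lt/(_ _ e1) := Ppure h.
apply: filterS => n; rewrite ltr_pdivlMr// => hn.
apply: le_lt_trans (hdot_CauchySchwarz _ _) _; apply: le_lt_trans hn.
by rewrite mulrC ler_wpM2l//; apply: le_trans (uM n) _; rewrite lerDl.
Qed.

Lemma poisson_isometry : exists W : boundedOp H (hardy (defectType Q)),
  (forall h n, W h n = to_closed_range D' (iter n Q h)) /\
  forall x y, hdot (W x) (W y) = hdot x y.
Proof.
have sqr_le h N : series (fun n => `|poisson_seq P h n| ^+ 2 : R[i]) N <= `|h| ^+ 2.
  have -> : (fun n => `|poisson_seq P h n| ^+ 2 : R[i]) =
      (fun n => hdot (poisson_seq P h n) (poisson_seq P h n)).
    by apply/funext => n; rewrite hdot_norm.
  by rewrite poisson_series// -hdot_norm gerBl hdot_ge0.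
have /choice[W WE] h : exists f : hardy (defectType Q), forall n, f n = poisson_seq P h n.
  exact: hardy_of_bounded (sqr_le h).
have Wdot x y : hdot (W x) (W y) = hdot x y.
  apply/cvg_lim; first exact: norm_hausdorff.
  have -> : series (fun n => hdot (W x n) (W y n)) =
      (fun N => hdot x y - hdot (iter N Q x) (iter N Q y)).
    apply/funext => N; rewrite -poisson_series//.
    by congr (series _ N); apply/funext => n; rewrite !WE.
  rewrite -[X in _ --> X]subr0; apply: cvgB; first exact: cvg_cst.
  by apply: (hdot_iterQ_cvg0 (M := `|x|)) => n; exact: iterQ_le.
have Wlin : linear W.
  move=> a u v; apply/val_inj/funext => n.
  rewrite -[RHS]/(a *: W u n + W v n) -[LHS]/(W _ n) !WE; apply: val_inj.
  rewrite -[RHS]/(a *: D' (iter n Q u) + D' (iter n Q v)) -linearP; congr (D' _).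
  by elim: n => //= n ->; rewrite linearP.
have Wnorm x : `|W x| <= 1 * `|x|.
  by rewrite mul1r -ler_sqr ?nnegrE// -!hdot_norm Wdot.
have [V VW] := boundedOp_of Wlin ler01 Wnorm.
by exists V; split=> [h n|x y]; rewrite !VW// WE.
Qed.

Variable W : boundedOp H (hardy (defectType Q)).
Hypothesis WE : forall h n, W h n = to_closed_range D' (iter n Q h).
Hypothesis Wdot : forall x y, hdot (W x) (W y) = hdot x y.

Lemma backshift_poisson h : hardy_backshift (W h) = W (Q h).
Proof. by apply/val_inj/funext => n /=; rewrite !WE iterSr. Qed.

Lemma char_mult_orthogonal f g h : char_mult P f g -> hdot (W h) g = 0.
Proof.
move=> /(char_mult_coef Ple)[x [x0 xS xle gE]].
rewrite hdotC; apply/eqP; rewrite fmorph_eq0; apply/eqP.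
apply/cvg_lim; first exact: norm_hausdorff.
have -> : series (fun n => hdot (g n) (W h n)) = (fun N => - hdot (x N) (iter N Q h)).
  apply/funext; elim=> [|N IH]; first by rewrite /series /= big_geq// x0 hdot0l oppr0.
  rewrite /series /= big_nat_recr//= -[X in X + _]/(series _ N) IH.
  rewrite WE -[hdot (g N) _]/(hdot (\val (g N)) (D' (iter N Q h))) gE.
  (* This amounts to [D' g_N = x_N - P x_{N+1}], from [D'^2 = I - P Q], [D' P = P D] and the state
     equation. *)
  rewrite -defect_sym// linearB /= defect_adjoint_sqr// -defect_intertwine//.
  rewrite xS -(adjointP P) linearD /= !(hdotBl, hdotDl); ring.
rewrite -oppr0; apply: cvgN; exact: hdot_iterQ_cvg0 xle.
Qed.

Lemma char_mult_of_orthogonal (g : hardy (defectType Q)) :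
  (forall h, hdot (W h) g = 0) -> exists f, char_mult P f g.
Proof.
move=> Wg.
pose x n := adjoint W (iter n (@hardy_backshift R (defectType Q)) g).
have x0 : x 0%N = 0 by apply: hdot_injr => h; rewrite -adjointP Wg hdot0r.
(* In the pairing with [W h], coefficient 0 yields [D' g_n]; the others yield [P x_{n+1}], since the
   backward shift carries [W h] to [W (Q h)]. *)
have xE n : x n = P (x n.+1) + D' (\val (g n)).
  apply: hdot_injr => h; rewrite -adjointP hdot_hardyS backshift_poisson WE.
  rewrite iter_backshiftE add0n hdotDr -defect_sym// (adjointPr P) -[in RHS]adjointP.
  by rewrite addrC.
have Wle h : `|W h| <= `|h| by rewrite -ler_sqr ?nnegrE// -!hdot_norm Wdot.
have xle n : `|x n| <= `|g|.
  apply: le_trans (adjoint_contraction Wle _) _.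
  by elim: n => //= n; apply: le_trans; exact: norm_hardy_backshift.
(* The block operator [[P D'; D -Q]] sends [(x_{n+1}, g_n)] to [(x_n, a_n)]. It is isometric, whence
   the energy identity below, and it inverts [[Q D; D' -P]], so the input [a] reproduces the states
   [x] and the output [g]. *)
have /choice[a aE] n : exists u : defectType P, \val u = D (x n.+1) - Q (\val (g n)).
  have [u uE] := adjoint_defect_space Ple (g n).
  by exists (to_closed_range D (x n.+1) - u); rewrite -uE.
have energy N : \sum_(0 <= n < N) `|a n| ^+ 2 =
    \sum_(0 <= n < N) `|g n| ^+ 2 + `|x N| ^+ 2.
  elim: N => [|N IH]; first by rewrite !big_geq// x0 normr0 expr0n addr0.
  rewrite !big_nat_recr//= IH -!addrA; congr (_ + _).
  rewrite {1}xE subspace_normE aE (subspace_normE (g N)) colligation_adjoint_norm//.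
  by rewrite addrC.
(* One [|g|^2] bounds the partial sums of [g], the other bounds [|x N|^2]. *)
have [|f fE] := @hardy_of_bounded _ _ a (`|g| ^+ 2 + `|g| ^+ 2).
  move=> N; rewrite /series /= energy; apply: lerD; first exact: hardy_series_le.
  by rewrite ler_sqr ?nnegrE.
exists f; apply: (@colligation_char_mult _ _ _ Ple f g x `|g|) => // n.
  rewrite fE aE (xE n) linearD linearB /= defect_sqr// defect_adjoint_intertwine//.
  by rewrite -[_ - _ - _]addrA -opprD [RHS]addrC subrK.
rewrite fE aE (xE n) linearD linearB /= defect_adjoint_sqr// defect_intertwine//.
by rewrite opprB [RHS]addrC addrA subrK [RHS]addrC subrK.
Qed.

(** For [g] in the model space, [d = g - W W^* g] is killed by [W^*], hence lies in the range of
    [M_Theta]. Both [g] and [W W^* g] are then orthogonal to [d], so [<d, d> = 0]. *)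
Lemma model_spaceP (g : hardy (defectType Q)) :
  subspace_set (model_space P) g <-> exists h, g = W h.
Proof.
split=> [gP|[h ->] g' [f fg']]; last exact: char_mult_orthogonal fg'.
exists (adjoint W g); apply/subr0_eq; set d := g - _.
have Wd h : hdot (W h) d = 0.
  by rewrite hdotBr Wdot adjointP subrr.
have [f fd] := char_mult_of_orthogonal Wd.
by apply: hdot_eq0; rewrite {1}/d hdotBl Wd subr0; apply: gP; exists f.
Qed.

End model.

(** Two candidates differ by a vector that lies in [W] and is orthogonal to [W]. *)
Lemma orth_proj_unique (R : realType) (K : hilbertType R) (W : closed_subspace K)
    (x : K) (y : subHilbert W) :
  orthogonal_to (subspace_set W) (x - \val y) -> orth_proj W x = y.
Proof.
move=> xy; have xz : orthogonal_to (subspace_set W) (x - \val (orth_proj W x)).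
  exact: (@getI _ [set y : subHilbert W |
    orthogonal_to (subspace_set W) (x - \val y)] y).
move: (orth_proj W x) xz => z xz; apply/subr0_eq/hdot_eq0.
have Wzy : subspace_set W (\val (z - y)) by exact/set_mem/subspace_valP.
rewrite -[hdot _ _]/(hdot (\val z - \val y) (\val (z - y))).
have -> : \val z - \val y = (x - \val y) - (x - \val z).
  by rewrite [RHS]addrC opprB addrA subrK.
by rewrite hdotBl xy// xz// subrr.
Qed.

(* Checked after applying the defect operator, which is injective on the defect
   space. *)
Lemma fundamental_operator_intertwine (R : realType) (H : hilbertType R)
    (S P : boundedOp H H) (F : boundedOp (defectType (adjoint P)) (defectType (adjoint P))) :
  (forall x, `|P x| <= `|x|) -> (forall x, S (P x) = P (S x)) ->
  fundamental_operator (adjoint S) (adjoint P) F ->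
  let t := to_closed_range (defect (adjoint P)) in
  forall y, F (t y) + adjoint F (t (adjoint P y)) = t (adjoint S y).
Proof.
move=> Ple SP SF t y; have Qle := adjoint_contraction Ple.
have FE x : defect (adjoint P) (\val (F (t x))) = adjoint S x - S (adjoint P x).
  by rewrite -SF adjointK.
(* The adjoint of the identity [D' F D' = S^* - S P^*] is [D' F^* D' = S - P S^*]; as [F] acts on
   the defect space, it is obtained by pairing with [w]. *)
have FaE z : defect (adjoint P) (\val (adjoint F (t z))) = S z - P (adjoint S z).
  apply: hdot_injr => w; rewrite -defect_sym//.
  rewrite -[hdot _ _]/(hdot (t w) (adjoint F (t z))) -adjointP.
  rewrite -[hdot _ _]/(hdot (\val (F (t w))) (defect (adjoint P) z)) -defect_sym// FE.
  by rewrite hdotBl hdotBr (adjointPr S) (adjointPr P) (adjointP S).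
apply/subr0_eq/(defect_inj Qle).
rewrite -[\val _]/(\val (F (t y)) + \val (adjoint F (t (adjoint P y)))
  - defect (adjoint P) (adjoint S y)).
(* The terms [S P^* y] cancel, and [S^* y - P S^* P^* y = (I - P P^* ) S^* y = D' D' S^* y]. *)
rewrite linearB linearD /= FE FaE defect_adjoint_sqr// (adjoint_commute SP).
by rewrite addrA subrK subrr.
Qed.

Theorem theorem3p1 (R : realType) (H : hilbertType R) (S P : boundedOp H H)
    (F : boundedOp (defectType (adjoint P)) (defectType (adjoint P))) :
  Gamma_contraction S P -> pure_op P ->
  fundamental_operator (adjoint S) (adjoint P) F ->
  exists U : boundedOp H (subHilbert (model_space P)),
    [/\ unitary_op U,
        forall x : H, U (S x) = model_S P F (U x) &
        forall x : H, U (P x) = model_P P (U x)].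
Proof.
move=> SP Ppure SF; have Ple := Gamma_contraction_norm_le SP; case: SP => SP _.
have [W [WE Wdot]] := poisson_isometry Ple Ppure.
have modelP := model_spaceP Ple Ppure WE Wdot.
have Wmodel x : W x \in subspace_pred (model_space P).
  by apply/mem_set/modelP; exists x.
have Ulin : linear (fun x => Subspace_of (Wmodel x)).
  by move=> a u v; apply: val_inj; rewrite /= linearP.
have Ule x : `|Subspace_of (Wmodel x)| <= 1 * `|x|.
  by rewrite mul1r -ler_sqr ?nnegrE// subspace_normE -!hdot_norm Wdot.
have [U UE] := boundedOp_of Ulin ler01 Ule.
have valU x : \val (U x) = W x by rewrite UE.
exists U; split=> [|x|x].
- split=> [x y|y]; first by rewrite !UE -[LHS]/(hdot (W x) (W y)).
  have [h yE] := iffLR (modelP _) (set_mem (subspace_valP y)).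
  by exists h; apply: val_inj; rewrite valU -yE.
(* Vectors of the model space have the form [W y]. Moving all operators onto [W y], the claim is
   that the adjoint of [I (x) F^* + M_z (x) F] maps [W y] to [W (S^* y)]. *)
- apply/esym/orth_proj_unique => _ /modelP[y ->]; rewrite !valU.
  rewrite hdotBl hdotDl hdot_id_tensor hdot_hardy_shift (backshift_poisson WE).
  rewrite hdot_id_tensor -hdotDr Wdot adjointP -Wdot; apply/eqP; rewrite subr_eq0.
  apply/eqP; congr (hdot _ _); apply/val_inj/funext => n.
  rewrite -[LHS]/(adjoint (adjoint F) (W y n) + adjoint F (W (adjoint P y) n)).
  rewrite -[RHS]/(W (adjoint S y) n) adjointK !WE -iterSr iterS.
  (* Used at [Q^n y], it yields [D' S^* Q^n y]; it remains to commute [S^*] past [Q^n]. *)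
  rewrite (fundamental_operator_intertwine Ple SP SF); congr to_closed_range.
  by elim: n => //= n IH; rewrite (adjoint_commute SP) IH.
(* The same test, with the backward shift as the adjoint of [M_z]: it maps [W y] to [W (P^* y)]. *)
- apply/esym/orth_proj_unique => _ /modelP[y ->]; rewrite !valU.
  rewrite hdotBl hdot_hardy_shift (backshift_poisson WE) Wdot adjointP.
  rewrite -Wdot; apply/eqP; rewrite subr_eq0; apply/eqP; congr (hdot _ _).
Qed.
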